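(* Let $M\subset\mathbb{R}^{2d}$ satisfy the standing assumptions below, let $T$ be its outer symplectic billiard map and let $F=\varphi_1$ be the time-one map of the flow $\varphi_t$ of the vector field $V$ defined below. Then there exist constants $\Delta>0$ and $K>0$, depending only on $M$, such that for all $x\in\mathbb{R}^{2d}$ with $|x|\ge \frac1\Delta$ one has $$|T^2(x)-F(x)|\le \frac{K}{|x|}.$$
   Context: Equip $\mathbb{R}^{2d}$ with the standard inner product $\langle\cdot,\cdot\rangle$, Euclidean norm $|\cdot|$, the standard complex structure $J$ (orthogonal, $J^2=-I$) and the symplectic form $\omega(u,v)=\langle Ju,v\rangle$. The Hamiltonian vector field $X_f$ of a function $f$ is defined by $\omega(\cdot,X_f)=df$, i.e. $X_f=J\nabla f$. Standing assumptions: $M\subset\mathbb{R}^{2d}$ is a smooth closed hypersurface bounding a strictly convex domain containing the origin in its interior, and $M$ is a level set of a smooth function with positive definite Hessian. For $q\in M$ the Reeb vector $R(q)$ is the unique vector with $\omega(v,R(q))=0$ for all $v\in T_qM$ and $\omega(q,R(q))=1$. Write $a\sim b$ if $a=\lambda b$ with $\lambda>0$. For $x$ in the exterior of $M$ there is a unique $m_-(x)\in M$ with $m_-(x)-x\sim R(m_-(x))$; the outer symplectic billiard map is $T(x)=2m_-(x)-x$. Let $G:M\to S^{2d-1}$ be the outward unit normal (Gauss) map, a diffeomorphism. For $x\neq 0$ put $n_+(x)=G^{-1}(-Jx/|x|)$, $n_-(x)=G^{-1}(Jx/|x|)$ (these are the points of $M$ with $R(n_+(x))\sim x$, $R(n_-(x))\sim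 -x$), and define the degree-zero homogeneous vector field $V(x)=2(n_+(x)-n_-(x))$ on $\mathbb{R}^{2d}\setminus\{0\}$; $\varphi_t$ denotes its flow. (Equivalently $V=-2X_H$ where $H$ is the positively $1$-homogeneous function whose unit level set is the symplectic polar $\{R'(q)\}$ of the symmetrization $M\oplus(-M)$, $R'$ being the Reeb vector of that symmetrization.) *)

(* Defs.v *)
(* R^{2d} is modelled as row vectors 'rV[R]_(d + d),
   the first d coordinates being q and the last d being p. *)
From HB Require Import structures.
From mathcomp Require Import all_boot all_order all_algebra.
From mathcomp Require Import all_classical all_reals all_analysis.
Set Implicit Arguments. Unset Strict Implicit. Unset Printing Implicit Defensive.
Import Order.TTheory GRing.Theory Num.Theory.
Import numFieldNormedType.Exports.
Local Open Scope classical_set_scope.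
Local Open Scope ring_scope.

Section SymplecticBilliards.
Variables (R : realType) (d : nat).

Definition vec := 'rV[R]_(d + d).

Definition dotp (u v : vec) : R := \sum_(i < d + d) u 0 i * v 0 i.
Definition enorm (u : vec) : R := Num.sqrt (dotp u u).

Definition Jc (u : vec) : vec := row_mx (- rsubmx u) (lsubmx u).
Definition omega (u v : vec) : R := dotp (Jc u) v.

Definition sim (a b : vec) : Prop := exists2 l : R, 0 < l & a = l *: b.

Fixpoint Ck (k : nat) (f : vec -> R) : Prop :=
  match k with
  | 0%N => continuous f
  | k'.+1 => [/\ continuous f, (forall a v, derivable f a v)
                & forall v, Ck k' (fun a => 'D_v f a)]
  end.
Definition smooth (f : vec -> R) : Prop := forall k, Ck k f.

Definition pos_def_hessian (g : vec -> R) : Prop :=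
  forall x v : vec, v != 0 -> 0 < 'D_v ('D_v g) x.

Definition strictly_convex_set (D : set vec) : Prop :=
  forall x y : vec, closure D x -> closure D y -> x != y ->
  forall t : R, 0 < t < 1 -> interior D (t *: x + (1 - t) *: y).

Definition standing_assumptions (M D : set vec) : Prop :=
  [/\ (0 < d)%N, [/\ open D, bounded_set D, strictly_convex_set D & D 0],
      M = (closure D `\` D) &
      exists (g : vec -> R) (c : R), [/\ smooth g, pos_def_hessian g &
                                        M = [set x | g x = c]]].

Definition tangent (M : set vec) (q v : vec) : Prop :=
  exists gam : R -> vec, [/\ forall t, M (gam t), gam 0 = q,
                             derivable gam 0 1 & 'D_1 gam 0 = v].

Definition is_reeb (M : set vec) (q r : vec) : Prop :=
  (forall v, tangent M q v -> omega v r = 0) /\ omega q r = 1.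
Definition reeb (M : set vec) (q : vec) : vec := xget 0 [set r | is_reeb M q r].

Definition exterior (M D : set vec) (x : vec) : Prop := ~ D x /\ ~ M x.
Definition m_minus (M : set vec) (x : vec) : vec :=
  xget 0 [set m | M m /\ sim (m - x) (reeb M m)].
Definition Tmap (M : set vec) (x : vec) : vec := 2%:R *: m_minus M x - x.

Definition is_outer_unit_normal (M D : set vec) (q nu : vec) : Prop :=
  [/\ enorm nu = 1, (forall v, tangent M q v -> dotp nu v = 0) &
      exists2 e : R, 0 < e & forall t : R, 0 < t < e -> ~ D (q + t *: nu)].
Definition gauss (M D : set vec) (q : vec) : vec :=
  xget 0 [set nu | is_outer_unit_normal M D q nu].
Definition gauss_inv (M D : set vec) (u : vec) : vec :=
  xget 0 [set q | M q /\ gauss M D q = u].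

Definition n_plus (M D : set vec) (x : vec) : vec :=
  gauss_inv M D (- ((enorm x)^-1 *: Jc x)).
Definition n_minus (M D : set vec) (x : vec) : vec :=
  gauss_inv M D ((enorm x)^-1 *: Jc x).
Definition Vfield (M D : set vec) (x : vec) : vec :=
  2%:R *: (n_plus M D x - n_minus M D x).

Definition is_integral_curve (M D : set vec) (gam : R -> vec) : Prop :=
  forall t : R, [/\ gam t != 0, derivable gam t 1 & 'D_1 gam t = Vfield M D (gam t)].
Definition time_one (M D : set vec) (x : vec) : vec :=
  xget 0 [set y | exists gam : R -> vec,
                    [/\ is_integral_curve M D gam, gam 0 = x & gam 1 = y]].

End SymplecticBilliards.

(* Main.v *)
Require Import Defs.
From HB Require Import structures.
From mathcomp Require Import all_boot all_order all_algebra.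
From mathcomp Require Import all_classical all_reals all_analysis.
From mathcomp Require Import ring lra.
Import Order.TTheory GRing.Theory Num.Theory.
Import numFieldNormedType.Exports.
Local Open Scope classical_set_scope.
Local Open Scope ring_scope.

Set Implicit Arguments.
Unset Strict Implicit.
Unset Printing Implicit Defensive.

(* Let N be the inverse Gauss map. Since M is a level set of a function whose Hessian
   is bounded below on compact sets, N is Lipschitz on the unit sphere, so that
   n_-(x) = N(Jx/|x|) and n_+(x) = n_-(-x) satisfy |n_-(x) - n_-(y)| = O(|x - y|/|x|).

   The tangency condition m - x ~ R(m) says exactly that m = n_-(x - m). For large x
   this is a fixed-point equation for a contraction, and it gives
   m_-(x) = n_-(x) + O(1/|x|). As T(x) = -x + O(1), applying this at x and at T(x)
   yields T^2(x) = x + 2 (n_+(x) - n_-(x)) + O(1/|x|) = x + V(x) + O(1/|x|).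

   Any integral curve of the bounded field V stays within O(1) of x up to time one,
   where V varies by O(1/|x|), hence F(x) = x + V(x) + O(1/|x|) as well. A complete
   integral curve exists because V is Hamiltonian for H(x) = h(Jx) + h(-Jx), h being the
   support function of M: the field (H / H(x)) V is globally Lipschitz, its flow preserves
   H, and therefore its trajectory through x is an integral curve of V avoiding 0. *)

(** * Euclidean geometry and the complex structure *)

Section Euclid.
Variables (R : realType) (d : nat).
Local Notation vec := (vec R d).
Implicit Types (u v w x y : vec) (a b : R).

Lemma dotpC u v : dotp u v = dotp v u.
Proof. by apply: eq_bigr => i _; rewrite mulrC. Qed.

Lemma dotpDl u v w : dotp (u + v) w = dotp u w + dotp v w.
Proof. by rewrite -big_split; apply: eq_bigr => i _; rewrite mxE mulrDl. Qed.

Lemma dotpDr u v w : dotp w (u + v) = dotp w u + dotp w v.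
Proof. by rewrite dotpC dotpDl !(dotpC w). Qed.

Lemma dotpZl a u v : dotp (a *: u) v = a * dotp u v.
Proof. by rewrite mulr_sumr; apply: eq_bigr => i _; rewrite mxE mulrA. Qed.

Lemma dotpZr a u v : dotp u (a *: v) = a * dotp u v.
Proof. by rewrite dotpC dotpZl dotpC. Qed.

Lemma dotpNl u v : dotp (- u) v = - dotp u v.
Proof. by rewrite -scaleN1r dotpZl mulN1r. Qed.

Lemma dotpNr u v : dotp u (- v) = - dotp u v.
Proof. by rewrite dotpC dotpNl dotpC. Qed.

Lemma dotpBl u v w : dotp (u - v) w = dotp u w - dotp v w.
Proof. by rewrite dotpDl dotpNl. Qed.

Lemma dotpBr u v w : dotp w (u - v) = dotp w u - dotp w v.
Proof. by rewrite dotpDr dotpNr. Qed.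

Lemma dotp0l u : dotp 0 u = 0.
Proof. by rewrite -(scale0r u) dotpZl mul0r. Qed.

Lemma dotp0r u : dotp u 0 = 0.
Proof. by rewrite dotpC dotp0l. Qed.

Lemma dotp_ge0 u : 0 <= dotp u u.
Proof. by apply: sumr_ge0 => i _; rewrite -expr2 sqr_ge0. Qed.

Lemma dotp_eq0 u : (dotp u u == 0) = (u == 0).
Proof.
apply/idP/eqP => [|->]; last by rewrite dotp0l.
rewrite psumr_eq0 => [/allP u0|i _]; last by rewrite -expr2 sqr_ge0.
apply/rowP => i; rewrite mxE; apply/eqP.
by have := u0 i; rewrite mem_index_enum -expr2 sqrf_eq0 => /(_ isT).
Qed.

Lemma enorm_ge0 u : 0 <= enorm u.
Proof. exact: sqrtr_ge0. Qed.

Lemma sqr_enorm u : enorm u ^+ 2 = dotp u u.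
Proof. by rewrite sqr_sqrtr ?dotp_ge0. Qed.

Lemma enorm_eq0 u : (enorm u == 0) = (u == 0).
Proof. by rewrite -dotp_eq0 -sqr_enorm sqrf_eq0. Qed.

Lemma enorm_gt0 u : (0 < enorm u) = (u != 0).
Proof. by rewrite lt_def enorm_ge0 andbT enorm_eq0. Qed.

Lemma enorm0 : enorm (0 : vec) = 0.
Proof. by apply/eqP; rewrite enorm_eq0. Qed.

Lemma enormZ a u : enorm (a *: u) = `|a| * enorm u.
Proof.
by rewrite /enorm dotpZl dotpZr mulrA -expr2 sqrtrM ?sqr_ge0// sqrtr_sqr.
Qed.

Lemma enormN u : enorm (- u) = enorm u.
Proof. by rewrite -scaleN1r enormZ normrN1 mul1r. Qed.

Lemma enormBC u v : enorm (u - v) = enorm (v - u).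
Proof. by rewrite -opprB enormN. Qed.

(** The squared norm of |v| u - |u| v equals 2 |u| |v| (|u| |v| - <u, v>), which is therefore
    nonnegative; the factor |u| |v| is then cancelled. *)
Lemma cauchy_schwarz u v : dotp u v <= enorm u * enorm v.
Proof.
have [->|u0] := eqVneq u 0; first by rewrite dotp0l enorm0 mul0r.
have [->|v0] := eqVneq v 0; first by rewrite dotp0r enorm0 mulr0.
move: u0 v0; rewrite -!enorm_gt0 => u0 v0.
have := dotp_ge0 (enorm v *: u - enorm u *: v).
rewrite !(dotpBl, dotpBr, dotpZl, dotpZr) -!sqr_enorm (dotpC v u) => H.
rewrite -(@ler_pM2l _ (enorm u * enorm v)) ?mulr_gt0//.
move: (enorm u) (enorm v) (dotp u v) H => p q r H.
lra.
Qed.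

Lemma enormD u v : enorm (u + v) <= enorm u + enorm v.
Proof.
rewrite -(@ler_pXn2r _ 2)// ?nnegrE ?addr_ge0 ?enorm_ge0//.
rewrite sqr_enorm dotpDl !dotpDr -!sqr_enorm (dotpC v u).
have := cauchy_schwarz u v; lra.
Qed.

Lemma enormB u v : enorm (u - v) <= enorm u + enorm v.
Proof. by rewrite -(enormN v) enormD. Qed.

Lemma enorm_tri w u v : enorm (u - v) <= enorm (u - w) + enorm (w - v).
Proof. by rewrite -[u - v](subrKA w) enormD. Qed.

Lemma enorm_le_dist u v : enorm u <= enorm v + enorm (u - v).
Proof. by rewrite -{1}(subrK v u) addrC enormD. Qed.

Lemma coord_le_enorm u i : `|u 0 i| <= enorm u.
Proof.
rewrite -(@ler_pXn2r _ 2)// ?nnegrE ?enorm_ge0//.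
rewrite sqr_enorm real_normK ?num_real// /dotp (bigD1 i)//= -expr2 lerDl.
by apply: sumr_ge0 => j _; rewrite -expr2 sqr_ge0.
Qed.

Lemma coord_le_norm n (u : 'rV[R]_n) i : `|u 0 i| <= `|u|.
Proof.
rewrite [leRHS]/Num.Def.normr/= mx_normrE.
exact: (le_bigmax _ (fun ij : 'I_1 * 'I_n => `|u ij.1 ij.2|) (0, i)).
Qed.

Lemma norm_rV_le n (u : 'rV[R]_n) a :
  0 <= a -> (forall i, `|u 0 i| <= a) -> `|u| <= a.
Proof.
move=> a0 ua; rewrite [leLHS]/Num.Def.normr/= mx_normrE.
by apply: bigmax_le => // -[i j] _ /=; rewrite (ord1 i).
Qed.

Lemma norm_le_enorm u : `|u| <= enorm u.
Proof. by apply: norm_rV_le (enorm_ge0 u) _ => i; exact: coord_le_enorm. Qed.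

(** Limits and derivatives use the sup norm of row vectors, the geometry uses [enorm]. The factor n
    = d + d, cruder than its square root, comes from n <= n^2. *)
Lemma enorm_le_norm u : enorm u <= (d + d)%:R * `|u|.
Proof.
rewrite -(@ler_pXn2r _ 2)// ?nnegrE ?mulr_ge0 ?enorm_ge0//.
rewrite sqr_enorm exprMn; apply: (@le_trans _ _ (\sum_(i < d + d) `|u| ^+ 2)).
  apply: ler_sum => i _; rewrite -expr2 -real_normK ?num_real//.
  by rewrite ler_pXn2r ?nnegrE ?coord_le_norm.
rewrite sumr_const card_ord -[leLHS]mulr_natl.
apply: ler_wpM2r; first exact: sqr_ge0.
by rewrite -natrX ler_nat; case: (d + d)%N => // n; rewrite expnS leq_pmulr ?expn_gt0.
Qed.

Lemma dotpJJ u v : dotp (Jc u) (Jc v) = dotp u v.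
Proof.
rewrite /dotp [RHS]big_split_ord [LHS]big_split_ord /= addrC /Jc.
congr (_ + _); apply: eq_bigr => i _.
  by rewrite !row_mxEr !mxE.
by rewrite !row_mxEl !mxE mulrNN.
Qed.

Lemma JcK u : Jc (Jc u) = - u.
Proof. by rewrite /Jc row_mxKl row_mxKr -opp_row_mx hsubmxK. Qed.

Lemma JcD u v : Jc (u + v) = Jc u + Jc v.
Proof. by rewrite /Jc add_row_mx !linearD. Qed.

Lemma JcZ a u : Jc (a *: u) = a *: Jc u.
Proof. by rewrite /Jc scale_row_mx !linearZ /= scalerN. Qed.

Lemma JcN u : Jc (- u) = - Jc u.
Proof. by rewrite -scaleN1r JcZ scaleN1r. Qed.

Lemma JcB u v : Jc (u - v) = Jc u - Jc v.
Proof. by rewrite JcD JcN. Qed.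

Lemma dotpJ u v : dotp (Jc u) v = - dotp u (Jc v).
Proof. by rewrite -dotpJJ JcK dotpNl. Qed.

Lemma dotpJ0 u : dotp (Jc u) u = 0.
Proof. by have := dotpJ u u; rewrite (dotpC u); lra. Qed.

Lemma enormJ u : enorm (Jc u) = enorm u.
Proof. by rewrite /enorm dotpJJ. Qed.

Lemma enorm_unit u : u != 0 -> enorm ((enorm u)^-1 *: u) = 1.
Proof.
move=> u0; rewrite enormZ ger0_norm ?invr_ge0 ?enorm_ge0//.
by rewrite mulVf ?enorm_eq0.
Qed.

(** After multiplication by |x| the difference becomes x - (|x|/|y|) y. Passing through y costs |x -
    y|, then ||y| - |x||, which is at most |x - y| again. *)
Lemma enorm_unit_dist x y : x != 0 -> y != 0 ->
  enorm ((enorm x)^-1 *: x - (enorm y)^-1 *: y) <= 2 * enorm (x - y) / enorm x.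
Proof.
rewrite -!enorm_gt0 => x0 y0.
have nx := gt_eqF x0; have ny := gt_eqF y0.
rewrite ler_pdivlMr// mulrC -{1}(gtr0_norm x0) -enormZ scalerBr.
rewrite !scalerA mulfV ?nx// scale1r.
apply: le_trans (enorm_tri y _ _) _.
rewrite mulr_natl mulr2n lerD2l -{1}(scale1r y) -scalerBl enormZ.
have -> : 1 - enorm x * (enorm y)^-1 = (enorm y - enorm x) / enorm y.
  by field; rewrite ny.
rewrite normrM normfV (gtr0_norm y0) mulfVK ?ny//.
rewrite ler_norml; apply/andP; split.
  by rewrite lerNl opprB lerBlDr addrC enorm_le_dist.
by rewrite lerBlDr addrC enormBC enorm_le_dist.
Qed.

End Euclid.

(** * Antiderivatives of continuous functions on the line *)

Section Antiderivative.
Variable R : realType.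
Implicit Types (f : R -> R) (a x y : R).
Local Notation mu := (@lebesgue_measure R).

(** The oriented integral from 0 to x; the sign is put in by hand because a set integral carries no
    orientation. *)
Definition primitive f (x : R) : R :=
  if 0 <= x then (\int[mu]_(t in `[0, x]) f t)%R
  else - (\int[mu]_(t in `[x, 0]) f t)%R.

Lemma continuous_integrable_cc f a x : continuous f ->
  mu.-integrable `[a, x] (EFin \o f).
Proof.
move=> cf; apply: continuous_compact_integrable; first exact: segment_compact.
exact: continuous_subspaceT.
Qed.

(** With a base point to the left of both 0 and x, the two sign cases merge into one formula, which
    the fundamental theorem differentiates even at x = 0. *)
Lemma primitiveE f a x : continuous f -> a < 0 -> a < x ->
  primitive f x =
  (\int[mu]_(t in `[a, x]) f t)%R - (\int[mu]_(t in `[a, 0%R]) f t)%R.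
Proof.
move=> cf a0 ax; rewrite /primitive; case: (leP 0 x) => x0.
  rewrite Rintegral_itvB ?bnd_simp ?(ltW a0)//; last exact: continuous_integrable_cc.
  rewrite Rintegral_itv_obnd_cbnd//.
  apply: integrableS (continuous_integrable_cc 0 x cf) => //.
  by apply: subset_itvr; rewrite bnd_simp.
rewrite -opprB; congr (- _).
rewrite Rintegral_itvB ?bnd_simp ?(ltW ax) ?(ltW x0)//; last exact: continuous_integrable_cc.
rewrite Rintegral_itv_obnd_cbnd//.
apply: integrableS (continuous_integrable_cc x 0 cf) => //.
by apply: subset_itvr; rewrite bnd_simp.
Qed.

Lemma is_derive_primitive f x : continuous f ->
  is_derive x 1 (primitive f) (f x).
Proof.
move=> cf; pose a : R := - `|x| - 1.
have a0 : a < 0 by rewrite /a; have := normr_ge0 x; lra.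
have ax : a < x by rewrite /a; have := ler_norm (- x); rewrite normrN; lra.
pose I0 := (\int[mu]_(t in `[a, 0%R]) f t)%R.
pose F y : R := (\int[mu]_(t in `[a, y]) f t)%R.
have [dF F'] : derivable F x 1 /\ derive1 F x = f x.
  apply: (@continuous_FTC1_closed _ _ _ _ (x + 1)) => //; first by lra.
    exact: continuous_integrable_cc.
  exact: cf.
have -> : f x = f x - 0 by rewrite subr0.
apply: (@near_eq_is_derive _ _ _ (F - cst I0)).
- near=> y; rewrite (@primitiveE f a y)//.
  by near: y; exact: lt_nbhsr.
- apply: is_deriveB.
  by apply: DeriveDef => //; rewrite -derive1E.
Unshelve. all: by end_near. Qed.

Lemma primitive0 f : primitive f 0 = 0.
Proof. by rewrite /primitive lexx set_itv1 Rintegral_set1. Qed.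

End Antiderivative.

(** * Mean value inequalities *)

Section MeanValue.
Variable R : realType.

Lemma is_derive_continuous (f : R -> R) (x df : R) : is_derive x 1 f df ->
  {for x, continuous f}.
Proof. by move=> [dfx _]; apply/differentiable_continuous/derivable1_diffP. Qed.

(** Both h - f and h + f have nonnegative derivative on [a, b]; the mean value theorem for each
    gives the two sides of the bound. *)
Lemma norm_diff_le_dominated (f f' h h' : R -> R) (a b : R) : a <= b ->
  (forall s : R, is_derive s (1 : R) f (f' s)) ->
  (forall s : R, is_derive s (1 : R) h (h' s)) ->
  (forall s, a <= s <= b -> `|f' s| <= h' s) ->
  `|f b - f a| <= h b - h a.
Proof.
move=> ab df dh fh.
have cts (k k' : R -> R) : (forall s : R, is_derive s (1 : R) k (k' s)) ->
    {within `[a, b], continuous k}.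
  move=> dk; apply: continuous_subspaceT => s; exact: is_derive_continuous (dk s).
have dB (s : R) : is_derive s (1 : R) (h - f) (h' s - f' s) by exact: is_deriveB.
have dD (s : R) : is_derive s (1 : R) (h + f) (h' s + f' s) by exact: is_deriveD.
have [c cab eB] := MVT_segment ab (fun s _ => dB s) (cts _ _ dB).
have [e eab eD] := MVT_segment ab (fun s _ => dD s) (cts _ _ dD).
move: cab eab; rewrite !in_itv /= => /fh; rewrite ler_norml => /andP[c1 c2].
move=> /fh; rewrite ler_norml => /andP[e1 e2].
have eB0 : 0 <= (h - f) b - (h - f) a.
  by rewrite eB mulr_ge0 ?subr_ge0.
have eD0 : 0 <= (h + f) b - (h + f) a.
  by rewrite eD mulr_ge0 ?subr_ge0//; lra.
move: eB0 eD0; rewrite !fctE => eB0 eD0.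
rewrite ler_norml; apply/andP; split; lra.
Qed.


(** For t >= 0 the bounding function has derivative k exp(2Lt), which dominates f'; negative times
    follow by reflection. This weight makes the Picard operator a contraction on the whole line at
    once. *)
Lemma norm_le_expR (f f' : R -> R) (k L : R) : 0 < L -> f 0 = 0 ->
  (forall s : R, is_derive s (1 : R) f (f' s)) ->
  (forall s, `|f' s| <= k * expR (2 * L * `|s|)) ->
  forall t, `|f t| <= k / (2 * L) * expR (2 * L * `|t|).
Proof.
move=> L0.
have k_ge0 (q : R -> R) : (forall s, `|q s| <= k * expR (2 * L * `|s|)) -> 0 <= k.
  by move=> /(_ 0); rewrite normr0 mulr0 expR0 mulr1; exact: le_trans.
pose h (s : R) := k / (2 * L) * expR (2 * L * s).
have dh (s : R) : is_derive s (1 : R) h (k * expR (2 * L * s)).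
  have dl : is_derive s (1 : R) (fun s : R => 2 * L * s) (2 * L).
    by apply: is_derive_eq; rewrite [LHS]mulr1.
  have de : is_derive s (1 : R) (expR \o (fun s : R => 2 * L * s))
      (expR (2 * L * s) * (2 * L)).
    exact: is_derive1_comp.
  have -> : h = (k / (2 * L)) *: (expR \o (fun s : R => 2 * L * s)) by [].
  apply: is_derive_eq; rewrite /GRing.scale /=; field.
  by rewrite gt_eqF.
have pos (p p' : R -> R) : p 0 = 0 -> (forall s : R, is_derive s (1 : R) p (p' s)) ->
    (forall s, `|p' s| <= k * expR (2 * L * `|s|)) ->
    forall t, 0 <= t -> `|p t| <= k / (2 * L) * expR (2 * L * t).
  move=> p0 dp bp t t0; have k0 := k_ge0 _ bp.
  have : `|p t - p 0| <= h t - h 0.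
    apply: norm_diff_le_dominated dp dh _ => // s /andP[s0 _].
    by have := bp s; rewrite (ger0_norm s0).
  rewrite p0 subr0 => /le_trans; apply.
  rewrite /h lerBlDr lerDl mulr_ge0 ?expR_ge0// divr_ge0//; lra.
move=> f0 df bf t.
have [t0|t0] := leP 0 t.
  rewrite (ger0_norm t0). exact: (pos f f' f0 df bf).
have := pos (f \o -%R) (fun s => - f' (- s)) _ _ _ (- t).
rewrite /= opprK (ltr0_norm t0); apply => //.
- by rewrite oppr0.
- move=> s; have -> : - f' (- s) = f' (- s) * - 1 by rewrite mulrN1.
  apply: is_derive1_comp.
- by move=> s; rewrite normrN -(normrN s).
- lra.
Qed.

End MeanValue.

(** * Global trajectories of a Lipschitz field by Picard iteration *)

Section Picard.
Variable R : realType.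

Lemma geometric_limit (V : completeNormedModType R) (u : nat -> V) (A : R) :
  (forall k, `|u k.+1 - u k| <= A / 2 ^+ k) ->
  exists l, forall k, `|l - u k| <= 2 * A / 2 ^+ k.
Proof.
move=> uA.
have A0 : 0 <= A by have := uA 0%N; rewrite expr0 divr1; exact: le_trans.
have p2 k : 0 < 2 ^+ k :> R by rewrite exprn_gt0.
(* Keeping the term - 2A/2^(k+j) makes the induction on j telescope. *)
have uD k j : `|u (k + j)%N - u k| <= 2 * A / 2 ^+ k - 2 * A / 2 ^+ (k + j).
  elim: j => [|j IH]; first by rewrite addn0 !subrr normr0.
  rewrite addnS -(subrKA (u (k + j)%N)).
  apply: le_trans (ler_normD _ _) _.
  have := uA (k + j)%N; rewrite exprS => H.
  have -> : 2 * A / (2 * 2 ^+ (k + j)) = A / 2 ^+ (k + j) :> R.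
    by field; rewrite gt_eqF.
  move: IH H; rewrite -!(mulrA 2); lra.
have uD' k j : `|u (k + j)%N - u k| <= 2 * A / 2 ^+ k.
  apply: le_trans (uD k j) _; rewrite lerBlDr lerDl.
  by apply: divr_ge0; [exact: mulr_ge0|exact: ltW (p2 _)].
have small (e : R) : 0 < e -> exists k, 2 * A / 2 ^+ k < e.
  move=> e0; have /cvgrPdist_lt/(_ e e0) : (geometric (2 * A) (2^-1 : R)) @ \oo --> 0.
    apply: cvg_geometric; rewrite ger0_norm ?invr_ge0// invf_lt1//; lra.
  move=> [k _ /(_ k (leqnn k))] /=; rewrite sub0r normrN /geometric /= exprVn.
  by move=> /(le_lt_trans (ler_norm _)); exists k.
have cu : cvgn u.
  apply/cauchy_cvgP/cauchy_exP => e e0; have [k ke] := small _ e0.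
  exists (u k); exists k => // j /= kj.
  rewrite -(subnKC kj) -ball_normE /= distrC.
  exact: le_lt_trans (uD' _ _) ke.
exists (limn u) => k; apply/ler_addgt0Pl => e e0.
have /cvgrPdist_lt/(_ e e0) [N _ /(_ (k + N)%N (leq_addl _ _)) /= Ne] := cu.
rewrite -(subrKA (u (k + N)%N)); apply: le_trans (ler_normD _ _) _.
exact: lerD (ltW Ne) (uD' _ _).
Qed.

Lemma le0_of_le_geometric (z A : R) : (forall k, z <= A / 2 ^+ k) -> z <= 0.
Proof.
move=> zA; apply/ler_addgt0Pl => e e0; rewrite addr0.
have /cvgrPdist_lt/(_ e e0) : (geometric A (2^-1 : R)) @ \oo --> 0.
  by apply: cvg_geometric; rewrite ger0_norm ?invr_ge0// invf_lt1//; lra.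
move=> [k _ /(_ k (leqnn k))] /=; rewrite sub0r normrN /geometric /= exprVn.
move=> /(le_lt_trans (ler_norm _)) H.
exact: le_trans (zA k) (ltW H).
Qed.

Lemma geometric_limit_rV n (u : nat -> 'rV[R]_n) (A : R) :
  (forall k, `|u k.+1 - u k| <= A / 2 ^+ k) ->
  exists l, forall k, `|l - u k| <= 2 * A / 2 ^+ k.
Proof.
move=> uA; have A0 : 0 <= A.
  by have := uA 0%N; rewrite expr0 divr1; exact: le_trans.
have ex i : exists l : R, forall k, `|l - u k 0 i| <= 2 * A / 2 ^+ k.
  apply: geometric_limit => k; apply: le_trans (uA k).
  by have := coord_le_norm (u k.+1 - u k) i; rewrite !mxE.
exists (\row_i sval (cid (ex i))) => k; apply: norm_rV_le => [|i].
  by rewrite divr_ge0 ?mulr_ge0// exprn_ge0.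
by rewrite !mxE; exact: (svalP (cid (ex i))).
Qed.

Variables (n : nat) (W : 'rV[R]_n -> 'rV[R]_n) (L : R).
Hypothesis W_lip : forall x y, `|W x - W y| <= L * `|x - y|.

Lemma row_is_derive (c : 'I_n -> R -> R) (v : 'rV[R]_n) (t : R) :
  (forall i, is_derive t (1 : R) (c i) (v 0 i)) ->
  is_derive t (1 : R) (fun t => \row_i c i t : 'rV[R]_n) v.
Proof.
move=> dc.
have E (i : 'I_1) (j : 'I_n) : (fun t => (\row_i c i t : 'rV[R]_n) i j) = c j.
  by apply/funext => s; rewrite mxE.
have dr : derivable (fun t => \row_i c i t : 'rV[R]_n) t 1.
  by apply/derivable_mxP => i j; rewrite E.
apply: DeriveDef => //; rewrite derive_mx//; apply/rowP => j; rewrite mxE E.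
exact: derive_val.
Qed.

Lemma lipschitz_rV_continuous : continuous W.
Proof.
have L0 : 0 <= `|L| + 1 by rewrite addr_ge0.
move=> x; apply/(@cvgrPdist_lt _ _ _ (nbhs x)) => e e0.
have e'0 : 0 < e / (`|L| + 1) by rewrite divr_gt0// ltr_wpDl.
apply/(@nbhs_normP R 'rV[R]_n x); exists (e / (`|L| + 1)) => //= y xy.
apply: le_lt_trans (W_lip x y) _.
apply: (@le_lt_trans _ _ ((`|L| + 1) * `|x - y|)).
  by apply: ler_wpM2r => //; apply: le_trans (ler_norm _) _; rewrite lerDl.
by rewrite mulrC -ltr_pdivlMr// ltr_wpDl.
Qed.

Definition picard_step (x : 'rV[R]_n) (gam : R -> 'rV[R]_n) (t : R) : 'rV[R]_n :=
  \row_i (x 0 i + primitive (fun s => W (gam s) 0 i) t).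

Lemma continuous_field_coord (gam : R -> 'rV[R]_n) i : continuous gam ->
  continuous (fun s => W (gam s) 0 i : R).
Proof.
move=> cg s; apply: (@continuous_comp _ _ _ (W \o gam) (fun v : 'rV_n => v 0 i)).
  by apply: continuous_comp; [exact: cg|exact: lipschitz_rV_continuous].
exact: coord_continuous.
Qed.

Lemma picard_step_coord x gam i (t : R) : continuous gam ->
  is_derive t (1 : R) (fun t => picard_step x gam t 0 i) (W (gam t) 0 i).
Proof.
move=> cg; have -> : (fun t => picard_step x gam t 0 i) =
    cst (x 0 i) + primitive (fun s => W (gam s) 0 i).
  by apply/funext => s; rewrite mxE.
rewrite -[W (gam t) 0 i]add0r.
have := is_derive_primitive t (@continuous_field_coord gam i cg).
exact: is_deriveD.
Qed.

Lemma picard_step_derive x gam (t : R) : continuous gam ->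
  is_derive t (1 : R) (picard_step x gam) (W (gam t)).
Proof.
move=> cg; apply: row_is_derive => i.
have := picard_step_coord x i t cg; congr (is_derive _ _ _ _).
by apply/funext => s; rewrite mxE.
Qed.

Lemma picard_step_continuous x gam : continuous gam ->
  continuous (picard_step x gam).
Proof.
move=> cg t; have [+ _] := picard_step_derive x t cg.
by move=> ?; apply/differentiable_continuous/derivable1_diffP.
Qed.

Lemma picard_step0 x gam : picard_step x gam 0 = x.
Proof. by apply/rowP => i; rewrite mxE primitive0 addr0. Qed.

(** The integrands differ by at most L k exp(2L|s|), and integration divides this by 2L: in the
    weighted norm the Picard operator halves distances. *)
Lemma picard_step_dist x gam del k : 0 < L -> continuous gam -> continuous del ->
  (forall s, `|gam s - del s| <= k * expR (2 * L * `|s|)) ->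
  forall t, `|picard_step x gam t - picard_step x del t|
            <= k / 2 * expR (2 * L * `|t|).
Proof.
move=> L0 cg cd gd t.
have k0 : 0 <= k.
  by have := gd 0; rewrite normr0 mulr0 expR0 mulr1; exact: le_trans.
apply: norm_rV_le => [|i]; first by rewrite mulr_ge0 ?expR_ge0// divr_ge0.
pose f s := picard_step x gam s 0 i - picard_step x del s 0 i.
have -> : (picard_step x gam t - picard_step x del t) 0 i = f t by rewrite /f !mxE.
have -> : k / 2 = (L * k) / (2 * L) by field; rewrite gt_eqF.
apply: (@norm_le_expR _ f (fun s => W (gam s) 0 i - W (del s) 0 i)) => //.
- by rewrite /f !picard_step0 subrr.
- move=> s; apply: (@is_deriveB _ _ _ (fun s => picard_step x gam s 0 i)
    (fun s => picard_step x del s 0 i)); exact: picard_step_coord.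
- move=> s.
  have -> : W (gam s) 0 i - W (del s) 0 i = (W (gam s) - W (del s)) 0 i.
    by rewrite !mxE.
  apply: le_trans (coord_le_norm _ _) _; apply: le_trans (W_lip _ _) _.
  by rewrite -mulrA ler_pM2l.
Qed.

Theorem lipschitz_flow (x : 'rV[R]_n) : 0 < L ->
  exists gam : R -> 'rV[R]_n, gam 0 = x /\
    forall t : R, is_derive t (1 : R) gam (W (gam t)).
Proof.
move=> L0.
pose u k := iter k (picard_step x) (cst x).
have cu k : continuous (u k).
  elim: k => [|k IH]; first by move=> t; exact: cvg_cst.
  exact: picard_step_continuous.
pose A := `|W x| / (2 * L).
have A0 : 0 <= A by rewrite divr_ge0// mulr_ge0// ltW.
have uS k t : `|u k.+1 t - u k t| <= A / 2 ^+ k * expR (2 * L * `|t|).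
  elim: k t => [|k IH] t.
    apply: norm_rV_le => [|i].
      by rewrite mulr_ge0 ?expR_ge0// divr_ge0// exprn_ge0.
    pose f s := picard_step x (cst x) s 0 i - x 0 i.
    have -> : (u 1%N t - u 0%N t) 0 i = f t by rewrite /f !mxE.
    rewrite expr0 divr1.
    apply: (@norm_le_expR _ f (fun s => W x 0 i - 0)) => //.
    - by rewrite /f !picard_step0 subrr.
    - move=> s; apply: (@is_deriveB _ _ _ (fun s => picard_step x (cst x) s 0 i)
        (cst (x 0 i))).
      exact: (@picard_step_coord x (cst x) i s (cu 0%N)).
    - move=> s; rewrite subr0; apply: le_trans (coord_le_norm _ _) _.
      by rewrite ler_peMr// -expR0 ler_expR mulr_ge0// mulr_ge0// ltW.
  have := @picard_step_dist x (u k.+1) (u k) _ L0 (cu _) (cu _) IH t.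
  by rewrite exprSr invfM mulrA.
have ex t : exists l, forall k, `|l - u k t| <= 2 * (A * expR (2 * L * `|t|)) / 2 ^+ k.
  by apply: geometric_limit_rV => k; rewrite mulrAC.
pose gam t := sval (cid (ex t)).
have gamP k t : `|gam t - u k t| <= 2 * A / 2 ^+ k * expR (2 * L * `|t|).
  apply: le_trans (svalP (cid (ex t)) k) _; rewrite le_eqVlt; apply/orP; left; apply/eqP; ring.
(* On |s - t| < 1 the weight is at most exp(2L(|t| + 1)), so the iterates converge uniformly there
   and an e/3 argument passes continuity to the limit. *)
have cgam : continuous gam.
  move=> t; apply/(@cvgrPdist_lt _ _ _ (nbhs t)) => e e0.
  pose B := 2 * A * expR (2 * L * (`|t| + 1)).
  have /cvgrPdist_lt/(_ (e / 3)) : (geometric B (2^-1 : R)) @ \oo --> 0.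
    by apply: cvg_geometric; rewrite ger0_norm ?invr_ge0// invf_lt1//; lra.
  move=> [|k _ /(_ k (leqnn k))]; first by rewrite divr_gt0.
  rewrite sub0r normrN /geometric /= exprVn => /(le_lt_trans (ler_norm _)) kB.
  have near_bound s : `|t - s| < 1 -> `|gam s - u k s| < e / 3.
    move=> ts; apply: le_lt_trans (gamP k s) _; apply: le_lt_trans kB.
    rewrite /B [leLHS]mulrAC; apply: ler_wpM2r; first by rewrite invr_ge0 exprn_ge0.
    apply: ler_wpM2l; first exact: mulr_ge0.
    rewrite ler_expR; apply: ler_wpM2l; first by rewrite mulr_ge0// ltW.
    rewrite -[s](subrK t) addrC; apply: le_trans (ler_normD _ _) _.
    by rewrite lerD2l distrC ltW.
  have e3 : 0 < e / 3 by rewrite divr_gt0.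
  have /cvgrPdist_lt/(_ _ e3) ck := cu k t.
  near=> s.
  have s1 : `|t - s| < 1 by near: s; exact: cvgr_dist_lt.
  have s2 : `|u k t - u k s| < e / 3 by near: s.
  have t1 : `|t - t| < 1 by rewrite subrr normr0.
  have h1 := near_bound t t1; have h2 := near_bound s s1.
  rewrite -(subrKA (u k t)); apply: le_lt_trans (ler_normD _ _) _.
  rewrite -(subrKA (u k s) (u k t)).
  have := ler_normD (u k t - u k s) (u k s - gam s).
  rewrite (distrC (u k s)); lra.
(* Up to the weight, both [gam] and its Picard image lie within A/2^k of the iterate [u k.+1];
   letting k grow identifies them. *)
have gamE : gam = picard_step x gam.
  apply/funext => t; apply/eqP; rewrite -subr_eq0 -normr_le0.
  apply: (@le0_of_le_geometric _ (2 * A * expR (2 * L * `|t|))) => k.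
  rewrite -(subrKA (u k.+1 t)); apply: le_trans (ler_normD _ _) _.
  have h1 := gamP k.+1 t.
  have H s : `|u k s - gam s| <= 2 * A / 2 ^+ k * expR (2 * L * `|s|).
    by rewrite distrC.
  have h2 := @picard_step_dist x (u k) gam (2 * A / 2 ^+ k) L0 (cu _) cgam H t.
  apply: le_trans (lerD h1 h2) _; rewrite exprS invfM le_eqVlt; apply/orP; left.
  by apply/eqP; field; rewrite expf_neq0.
exists gam; split; first by rewrite gamE picard_step0.
by move=> t; rewrite {1}gamE; exact: picard_step_derive.
Unshelve. all: by end_near. Qed.

End Picard.

(** * Directional derivatives of C^1 functions *)

Section LineDerivatives.
Variables (R : realType) (n : nat).
Local Notation V := 'rV[R]_n.

Lemma is_derive_line (W : normedModType R) (f : V -> W) (a v : V) (t : R) :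
  derivable f (a + t *: v) v ->
  is_derive t (1 : R) (fun s => f (a + s *: v)) ('D_v f (a + t *: v)).
Proof.
have E : (fun h : R => h^-1 *: (((fun s => f (a + s *: v)) \o shift t) (h *: (1 : R))
      - f (a + t *: v)))
    = (fun h : R => h^-1 *: ((f \o shift (a + t *: v)) (h *: v) - f (a + t *: v))).
  apply/funext => h /=; congr (_ *: (f _ - _)).
  by rewrite [h *: _]mulr1 scalerDl addrCA.
by move=> dfv; split; rewrite /derivable /derive E.
Qed.

Lemma line_quotient_near (f : V -> R) (a v : V) (e : R) : 0 < e ->
  derivable f a v ->
  exists2 del : R, 0 < del &
    forall t : R, 0 < t < del ->
      `|(f (a + t *: v) - f a) - t * 'D_v f a| <= e * t.
Proof.
move=> e0 /cvgrPdist_le/(_ e e0) [del /= del0 H]; exists del => // t /andP[t0 td].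
have := H t; rewrite /ball_ /= sub0r normrN (gtr0_norm t0) => /(_ td).
rewrite gt_eqF// => /(_ isT).
rewrite [t *: v + a]addrC => Ht.
rewrite -ler_pdivrMr// -[X in _ / X <= _](gtr0_norm t0) -normfV -normrM mulrBl.
rewrite (mulrC t) mulfK ?gt_eqF// distrC.
by move: Ht; rewrite /derive /GRing.scale /= mulrC.
Qed.

Lemma continuous_rVP (W : normedModType R) (f : V -> W) (a : V) :
  {for a, continuous f} -> forall e : R, 0 < e ->
  exists2 del : R, 0 < del & forall y, `|a - y| < del -> `|f a - f y| < e.
Proof.
move=> cf e e0.
have /(@cvgrPdist_lt _ _ _ (nbhs a))/(_ e e0) /(@nbhs_normP R V a)[del d0 H] := cf.
by exists del => // y /H.
Qed.

(** The format follows [Ck], which speaks of directional derivatives only; linearity in the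
    direction is derived from continuity in the point. *)
Definition C1 (f : V -> R) :=
  (forall a v, derivable f a v) /\ (forall v, continuous ('D_v f)).

(** The increment along t(u + v) is split at a + t u. By the mean value theorem the second leg is t
    times ['D_v f] at an intermediate point, and continuity of ['D_v f] replaces that point by a
    with an error of order e t. *)
Lemma C1_deriveD (f : V -> R) a u v : C1 f ->
  'D_(u + v) f a = 'D_u f a + 'D_v f a.
Proof.
move=> [df cf]; apply/eqP; rewrite -subr_eq0 -normr_le0; apply/ler_addgt0Pl => e e0.
rewrite addr0; have e3 : 0 < e / 3 by rewrite divr_gt0.
have [d1 d10 H1] := line_quotient_near e3 (df a (u + v)).
have [d2 d20 H2] := line_quotient_near e3 (df a u).
have [d3 d30 H3] := continuous_rVP (cf v a) e3.
pose w := `|u| + `|v| + 1.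
have w0 : 0 < w by rewrite ltr_wpDl// addr_ge0.
(* The bound t < d3 / w keeps the intermediate point a + t u + s v, with 0 <= s <= t, within d3 of
   a. *)
pose t := Num.min (Num.min d1 d2) (d3 / w) / 2.
have m0 : 0 < Num.min (Num.min d1 d2) (d3 / w).
  by rewrite !lt_min d10 d20 divr_gt0.
have t0 : 0 < t by rewrite divr_gt0.
have tm : t < Num.min (Num.min d1 d2) (d3 / w) by rewrite /t; lra.
move: tm; rewrite !lt_min -andbA => /and3P[t1 t2 t3]; clearbody t.
have := H1 t; rewrite t0 t1 => /(_ isT) {}H1.
have := H2 t; rewrite t0 t2 => /(_ isT) {}H2.
have dl s : is_derive s (1 : R) (fun s => f (a + t *: u + s *: v))
    ('D_v f (a + t *: u + s *: v)) by exact: is_derive_line.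
have [|s] := MVT_segment (ltW t0) (fun s _ => dl s).
  by apply: continuous_subspaceT => s; exact: is_derive_continuous (dl s).
rewrite in_itv /= => /andP[s0 st]; rewrite scale0r addr0 subr0 => E.
have {}H3 : `|'D_v f a - 'D_v f (a + t *: u + s *: v)| < e / 3.
  apply: H3; rewrite -addrA opprD addNKr normrN.
  apply: le_lt_trans (ler_normD _ _) _; rewrite !normrZ. rewrite (gtr0_norm t0) (ger0_norm s0).
  move: t3; rewrite ltr_pdivlMr// /w => t3.
  apply: le_lt_trans t3; rewrite !mulrDr mulr1 -addrA lerD2l.
  have := ler_wpM2r (normr_ge0 v) st; lra.
have E' : f (a + t *: (u + v)) - f (a + t *: u) = 'D_v f (a + t *: u + s *: v) * t.
  by rewrite -E scalerDr addrA.
move: H1 H2 H3 E'; set A := f (a + t *: (u + v)); set B := f (a + t *: u).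
set C := 'D_v f (_ + _); set X := 'D_(u + v) f a; set Y := 'D_u f a.
set Z := 'D_v f a => H1 H2 H3 E'.
rewrite -(ler_pM2r t0) -{1}(gtr0_norm t0) -normrM.
have -> : (X - (Y + Z)) * t = - (A - f a - t * X) + (B - f a - t * Y) + (C - Z) * t.
  by move: E' => /eqP; rewrite subr_eq => /eqP ->; ring.
apply: le_trans (ler_normD _ _) _.
have H4 : `|(C - Z) * t| <= e / 3 * t.
  by rewrite normrM (gtr0_norm t0) ler_pM2r// distrC ltW.
have := ler_normD (- (A - f a - t * X)) (B - f a - t * Y).
rewrite normrN; lra.
Qed.

Lemma C1_deriveZ (f : V -> R) a (k : R) v : C1 f ->
  'D_(k *: v) f a = k * 'D_v f a.
Proof.
move=> [df _].
have d1 : is_derive (0 : R) (1 : R) (fun s => f (a + s *: (k *: v))) ('D_(k *: v) f a).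
  have := @is_derive_line _ f a (k *: v) 0; rewrite scale0r addr0; apply.
  exact: df.
have d2 : is_derive (k * 0) (1 : R) (fun s => f (a + s *: v)) ('D_v f a).
  have := @is_derive_line _ f a v 0; rewrite mulr0 scale0r addr0; apply.
  exact: df.
have dl : is_derive (0 : R) (1 : R) (fun s : R => k * s) k.
  by apply: is_derive_eq; rewrite [LHS]mulr1.
have := is_derive1_comp d2 dl.
have -> : (fun s => f (a + s *: v)) \o (fun s : R => k * s) =
    (fun s => f (a + s *: (k *: v))).
  by apply/funext => s /=; rewrite scalerA (mulrC s).
by move=> [_ E2]; case: d1 => _ <-; rewrite E2 mulrC.
Qed.

Lemma C1_derive_sum (f : V -> R) a v : C1 f ->
  'D_v f a = \sum_i v 0 i * 'D_(delta_mx 0 i) f a.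
Proof.
move=> cf; rewrite {1}[v]row_sum_delta.
rewrite (big_morph (fun v => 'D_v f a) (fun u w => C1_deriveD a u w cf) (derive0 f a)).
by apply: eq_bigr => i _; rewrite C1_deriveZ.
Qed.

(** Let p be f along the segment minus its linear part and k t^2 / 2. The increment of p over [0, 1]
    is p'(c), and a second mean value step gives p'(c) = c (f''(e) - k) >= 0, with f''(e) the second
    derivative along v at a + e v. *)
Lemma taylor2_ge (f : V -> R) (a v : V) (k : R) :
  (forall a v, derivable f a v) -> (forall a v, derivable ('D_v f) a v) ->
  (forall t : R, 0 <= t <= 1 -> k <= 'D_v ('D_v f) (a + t *: v)) ->
  f a + 'D_v f a + k / 2 <= f (a + v).
Proof.
move=> df ddf fk.
have d1 t : is_derive t (1 : R) (fun s => f (a + s *: v)) ('D_v f (a + t *: v)).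
  exact: is_derive_line.
have d2 t : is_derive t (1 : R) (fun s => 'D_v f (a + s *: v))
    ('D_v ('D_v f) (a + t *: v)).
  exact: is_derive_line.
pose p (t : R) : R := f (a + t *: v) + (- ('D_v f a * t) + - (k / 2 * t ^+ 2)).
have dp (t : R) : is_derive t (1 : R) p ('D_v f (a + t *: v) + (- 'D_v f a - k * t)).
  have dq : is_derive t (1 : R) (fun t : R => - ('D_v f a * t) + - (k / 2 * t ^+ 2))
      (- 'D_v f a - k * t).
    by apply: is_derive_eq; rewrite /GRing.scale /=; field.
  exact: is_deriveD.
have cts (q q' : R -> R) b : (forall s : R, is_derive s (1 : R) q (q' s)) ->
    {within `[0, b], continuous q}.
  by move=> dq; apply: continuous_subspaceT => s; exact: is_derive_continuous (dq s).
have [c] := MVT_segment ler01 (fun s _ => dp s) (cts _ _ _ dp).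
rewrite in_itv /= => /andP[c0 c1].
have [e] := MVT_segment c0 (fun s _ => d2 s) (cts _ _ _ d2).
rewrite in_itv /= => /andP[e0 ec]; rewrite scale0r addr0 subr0 => E1.
rewrite /p scale0r scale1r addr0 => E2.
have fe : k <= 'D_v ('D_v f) (a + e *: v) by apply: fk; rewrite e0 (le_trans ec).
have := ler_wpM2r c0 fe; rewrite -E1; lra.
Qed.

End LineDerivatives.

Lemma continuous_sum (R : realType) (T : topologicalType) (I : Type) (r : seq I)
    (F : I -> T -> R) : (forall i, continuous (F i)) ->
  continuous (fun x => \sum_(i <- r) F i x).
Proof.
move=> cF; elim: r => [|i r IH] x.
  under eq_fun do rewrite big_nil; exact: cvg_cst.
under eq_fun do rewrite big_cons; apply: continuousD; [exact: cF|exact: IH].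
Qed.

(** * The Hessian form and strong convexity on balls *)

Section Hessian.
Variables (R : realType) (n : nat).
Local Notation V := 'rV[R]_n.
Variable g : V -> R.
Hypotheses (g1 : C1 g) (g2 : forall v, C1 ('D_v g)).

Definition hess (i j : 'I_n) : V -> R := 'D_(delta_mx 0 j) ('D_(delta_mx 0 i) g).

(** The coordinate expansion yields both the homogeneity of degree two in v and the joint continuity
    in (x, v). *)
Lemma second_deriveE (x v : V) :
  'D_v ('D_v g) x = \sum_j \sum_i v 0 j * v 0 i * hess i j x.
Proof.
rewrite C1_derive_sum//; apply: eq_bigr => j _.
have -> : 'D_v g = \sum_i (v 0 i *: 'D_(delta_mx 0 i) g : V -> R).
  by apply/funext => y; rewrite C1_derive_sum// fct_sumE.
rewrite derive_sum => [|i]; last by apply: derivableZ; exact: (g2 _).1.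
rewrite mulr_sumr; apply: eq_bigr => i _; rewrite deriveZ//.
  by rewrite mulrA.
exact: (g2 _).1.
Qed.

Lemma second_deriveZ (x v : V) (k : R) :
  'D_(k *: v) ('D_(k *: v) g) x = k ^+ 2 * 'D_v ('D_v g) x.
Proof.
rewrite !second_deriveE mulr_sumr; apply: eq_bigr => j _.
rewrite mulr_sumr; apply: eq_bigr => i _; rewrite !mxE; ring.
Qed.

Lemma second_derive_continuous :
  continuous (fun p : V * V => 'D_p.2 ('D_p.2 g) p.1).
Proof.
have -> : (fun p : V * V => 'D_p.2 ('D_p.2 g) p.1) =
    (fun p => \sum_j \sum_i p.2 0 j * p.2 0 i * hess i j p.1).
  by apply/funext => p; rewrite second_deriveE.
have cc i : continuous (fun p : V * V => p.2 0 i : R).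
  move=> p; apply: (@continuous_comp _ _ _ snd (fun v : V => v 0 i : R)).
    exact: cvg_snd.
  exact: coord_continuous.
apply: continuous_sum => j; apply: continuous_sum => i p.
apply: (@continuousM R _ (fun p : V * V => p.2 0 j * p.2 0 i)
  (fun p => hess i j p.1)).
  by apply: (@continuousM R _ (fun p : V * V => p.2 0 j) (fun p => p.2 0 i)); exact: cc.
apply: (@continuous_comp _ _ _ fst (hess i j)); first exact: cvg_fst.
exact: (g2 _).2.
Qed.

Lemma closed_norm_le (B : R) : closed [set x : V | `|x| <= B].
Proof.
have -> : [set x : V | `|x| <= B] = (fun x : V => `|x|) @^-1` [set r | r <= B] by [].
apply: closed_comp; last exact: closed_le.
by move=> x _; exact: norm_continuous.
Qed.

Lemma compact_norm_le (B : R) : compact [set x : V | `|x| <= B].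
Proof.
apply: bounded_closed_compact; last exact: closed_norm_le.
by exists B; split => // [|r Br x /= /le_trans]; [exact: num_real|apply; exact: ltW].
Qed.

Lemma compact_norm_eq1 : compact [set v : V | `|v| = 1].
Proof.
apply: (@subclosed_compact _ _ [set x : V | `|x| <= 1]);
  [|exact: compact_norm_le|by move=> v /= ->].
have -> : [set v : V | `|v| = 1] = (fun x : V => `|x|) @^-1` [set r | r = 1] by [].
apply: closed_comp; last exact: closed_eq.
by move=> x _; exact: norm_continuous.
Qed.

Lemma strong_convexity_constant (B : R) :
  (forall x v : V, v != 0 -> 0 < 'D_v ('D_v g) x) ->
  exists2 m : R, 0 < m &
    forall x v : V, `|x| <= B -> m * `|v| ^+ 2 <= 'D_v ('D_v g) x.
Proof.
move=> gpos.
(* By homogeneity a lower bound on unit vectors v suffices, and on this compact product the form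
   attains a positive minimum. *)
pose K := [set x : V | `|x| <= B] `*` [set v : V | `|v| = 1].
have scale (m : R) : (forall x v : V, `|x| <= B -> `|v| = 1 -> m <= 'D_v ('D_v g) x) ->
    forall x v : V, `|x| <= B -> m * `|v| ^+ 2 <= 'D_v ('D_v g) x.
  move=> H x v xB; have [->|v0] := eqVneq v 0.
    by rewrite normr0 expr0n mulr0 derive0.
  have nv : `|v| != 0 by rewrite normr_eq0.
  have -> : v = `|v| *: (`|v|^-1 *: v) by rewrite scalerA mulfV// scale1r.
  rewrite second_deriveZ mulrC; set w := `|v|^-1 *: v.
  have w1 : `|w| = 1 by rewrite /w normrZ normfV normr_id mulVf.
  rewrite normrZ w1 normr_id mulr1; apply: ler_wpM2l; first exact: sqr_ge0.
  exact: H.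
(* K is empty if B < 0 or n = 0; any positive constant serves then. *)
have [K0|/set0P/negP/negPn/eqP K0] := pselect (K !=set0); last first.
  exists 1 => //; apply: scale => x v xB v1.
  by have : K (x, v) by []; rewrite K0.
have cK : compact K by apply: compact_setX; [exact: compact_norm_le|exact: compact_norm_eq1].
have [|[x v] + H] := compact_EVT_min K0 cK (f := fun p => 'D_p.2 ('D_p.2 g) p.1).
  exact: continuous_subspaceT second_derive_continuous.
rewrite inE => -[/= xB v1]; exists ('D_v ('D_v g) x).
  by apply: gpos; rewrite -normr_eq0 v1 oner_eq0.
by apply: scale => y w yB w1; apply: (H (y, w)); rewrite inE.
Qed.

End Hessian.

(** * First-order tests along curves *)

Section CurveTests.
Variables (R : realType).

Lemma derive_at_max_eq0 (f : R -> R) (l : R) :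
  is_derive (0 : R) (1 : R) f l -> (forall t, f t <= f 0) -> l = 0.
Proof.
move=> [df fl] fmax; apply/eqP; apply/negPn/negP => l0.
have nl : 0 < `|l| by rewrite normr_gt0.
have /cvgrPdist_lt/(_ _ nl) [del /= del0] := df.
have -> : lim ((fun h : R => h^-1 *: ((f \o shift 0) (h *: (1 : R)) - f 0)) @ 0^') = l.
  by rewrite -fl.
(* A small step with the sign of l: its difference quotient is closer to l than |l|, hence has the
   sign of l, whereas maximality at 0 makes its product with l nonpositive. *)
pose h : R := Num.sg l * (del / 2).
have hl : 0 < h * l.
  by rewrite /h mulrAC mulrC mulr_gt0 ?divr_gt0// -normrEsg.
have h0 : h != 0 by apply/eqP => h0; move: hl; rewrite h0 mul0r ltxx.
have hd : `|h| < del.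
  rewrite /h normrM normr_sg l0 mul1r gtr0_norm ?divr_gt0//; lra.
move=> /(_ h); rewrite /ball_ /= sub0r normrN => /(_ hd h0).
rewrite addr0 [h *: 1]mulr1.
have fh := fmax h; rewrite /GRing.scale /=.
set q := h^-1 * _.
have ql : q * l <= 0.
  have -> : q * l = (f h - f 0) * (h * l) / h ^+ 2 by rewrite /q; field.
  rewrite -mulrA mulr_le0_ge0 ?subr_le0// divr_ge0 ?sqr_ge0//; exact: ltW.
move=> /ltr_normlP[]; rewrite opprB.
case: (ltrgt0P l) l0 => [l0 _|l0 _|->]; last by [].
- move=> a1 a2; have q0 : 0 < q by lra.
  by have := mulr_gt0 q0 l0; lra.
- move=> a1 a2; have q0 : q < 0 by lra.
  have := mulr_gt0 (x := - q) (y := - l); rewrite !oppr_gt0 => /(_ q0 l0); lra.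
Qed.

(** Divided by h, the deviation from the line is at most |C| |phi(t + h) / h|, which tends to 0.
    This differentiates functions controlled only through an estimate: the radial projection to M
    and the energy along a trajectory. *)
Lemma is_derive_tangent (W : normedModType R) (f : R -> W) (v : W) (phi : R -> R)
    (t C : R) : is_derive t (1 : R) phi 0 -> phi t = 0 ->
  (forall s, `|s - t| < 1 -> `|f s - f t - (s - t) *: v| <= C * `|phi s|) ->
  is_derive t (1 : R) f v.
Proof.
move=> [dphi phi'] phit fv.
suff cv : (fun h : R => h^-1 *: ((f \o shift t) (h *: (1 : R)) - f t)) @ 0^' --> v.
  by split; [apply/cvg_ex; exists v|exact/cvg_lim].
have C0 : 0 < `|C| + 1 by rewrite ltr_wpDl.
apply/cvgrPdist_le => e e0.
have e'0 : 0 < e / (`|C| + 1) by rewrite divr_gt0.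
have /cvgrPdist_le/(_ _ e'0) [del /= del0] := dphi.
have -> : lim ((fun h : R => h^-1 *: ((phi \o shift t) (h *: (1 : R)) - phi t)) @ 0^') = 0.
  exact: phi'.
move=> H; exists (Num.min del 1) => /=; first by rewrite lt_min del0 ltr01.
move=> h; rewrite /ball_ /= sub0r normrN lt_min => /andP[hd h1] h0.
have := H h; rewrite /ball_ /= sub0r normrN => /(_ hd h0).
rewrite ![h *: 1]mulr1 phit subr0 sub0r normrN /GRing.scale /= normrM => Ht.
have := fv (h + t); rewrite addrK => /(_ h1) {}fv.
have -> : v - h^-1 *: (f (h + t) - f t) = - (h^-1 *: (f (h + t) - f t - h *: v)).
  by rewrite [in RHS]scalerBr scalerA mulVf// scale1r opprB.
rewrite normrN normrZ.
apply: le_trans (ler_wpM2l (normr_ge0 _) fv) _.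
rewrite mulrCA; apply: (@le_trans _ _ ((`|C| + 1) * (`|h^-1| * `|phi (h + t)|))).
  apply: ler_wpM2r; first exact: mulr_ge0.
  by apply: le_trans (ler_norm _) _; rewrite lerDl.
by rewrite mulrC -ler_pdivlMr.
Qed.

End CurveTests.

(** * Convexity and topology of the domain bounded by M *)

Section Hypersurface.
Variables (R : realType) (d : nat).
Local Notation vec := (vec R d).
Variables (M D : set vec) (g : vec -> R) (c : R).
Hypotheses (d_gt0 : (0 < d)%N) (D_open : open D) (D_bounded : bounded_set D).
Hypotheses (D0 : D 0) (MD : M = closure D `\` D) (Mg : M = [set x | g x = c]).
Hypotheses (g_cont : continuous g) (g1 : C1 g) (g2 : forall v, C1 ('D_v g)).
Hypothesis g_hess : forall x v : vec, v != 0 -> 0 < 'D_v ('D_v g) x.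

Definition grad (x : vec) : vec := \row_i 'D_(delta_mx 0 i) g x.

Lemma derive_grad x v : 'D_v g x = dotp (grad x) v.
Proof. by rewrite C1_derive_sum//; apply: eq_bigr => i _; rewrite mxE mulrC. Qed.

Lemma convex_tangent x y : g x + dotp (grad x) (y - x) <= g y.
Proof.
have := @taylor2_ge R _ g x (y - x) 0 g1.1 (fun a v => (g2 v).1 a v).
rewrite derive_grad mul0r addr0 subrKC; apply => t _.
have [->|v0] := eqVneq (y - x) 0; first by rewrite derive0.
exact/ltW/g_hess.
Qed.

Lemma MP x : M x <-> g x = c.
Proof. by rewrite Mg. Qed.

Lemma D_not_M x : D x -> ~ M x.
Proof. by rewrite MD => Dx [_]. Qed.

Lemma line_continuous (x v : vec) : continuous (fun s : R => x + s *: v).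
Proof.
move=> s; apply: (@continuousD _ _ _ (cst x) (fun s : R => s *: v)).
  exact: cvg_cst.
exact: scalel_continuous.
Qed.

Lemma D_line_near (x v : vec) (t : R) : D (x + t *: v) ->
  exists2 e : R, 0 < e & forall s, `|t - s| < e -> D (x + s *: v).
Proof.
move=> Dt; have : nbhs (x + t *: v) D by exact: open_nbhs_nbhs.
move=> /(@line_continuous x v t) /nbhs_normP[e /= e0 H].
by exists e => // s /H.
Qed.

(** The crossing happens at the infimum t0 of the times outside D: openness of D puts t0 itself
    outside, and earlier times, being inside, put it in the closure. *)
Lemma exit_segment (x v : vec) : D x -> ~ D (x + v) ->
  exists2 t : R, 0 < t <= 1 & M (x + t *: v).
Proof.
move=> Dx nDv.
pose E := [set t : R | 0 <= t /\ ~ D (x + t *: v)].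
have E1 : E 1 by split; rewrite ?scale1r.
have lbE : lbound E 0 by move=> t [].
have hE : has_inf E by split; [exists 1|exists 0].
pose t0 := inf E.
have t01 : t0 <= 1 by apply: ge_inf => //; exists 0.
have t00 : 0 <= t0 by apply: lb_le_inf => //; exists 1.
have below s : 0 <= s -> s < t0 -> D (x + s *: v).
  move=> s0 st; apply: contrapT => nD.
  have : t0 <= s by apply: ge_inf; [exists 0|split].
  by rewrite leNgt st.
have nD0 : ~ D (x + t0 *: v).
  move=> /D_line_near[e e0 He].
  have [t Et tt] := inf_adherent e0 hE.
  apply: Et.2; apply: He; rewrite distrC ger0_norm ?subr_ge0.
    by rewrite ltrBlDl.
  by apply: ge_inf => //; exists 0.
have t0p : 0 < t0.
  rewrite lt_def t00 andbT; apply/eqP => t0E.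
  by apply: nD0; rewrite t0E scale0r addr0.
exists t0; first by rewrite t0p.
rewrite MD; split => // A /(@line_continuous x v t0) /nbhs_normP[e /= e0 H].
pose s := t0 - Num.min t0 e / 2.
have m0 : 0 < Num.min t0 e by rewrite lt_min t0p.
have mt : Num.min t0 e <= t0 by rewrite ge_min lexx.
have me : Num.min t0 e <= e by rewrite ge_min lexx orbT.
exists (x + s *: v); split; first by apply: below; rewrite /s; lra.
apply: H; rewrite /s /= opprB addrC subrK gtr0_norm ?divr_gt0//; lra.
Qed.

Lemma M_bounded : exists2 B : R, 0 < B & forall x, M x -> `|x| <= B.
Proof.
have [B [_ HB]] := D_bounded.
exists (`|B| + 1); first by rewrite ltr_wpDl.
move=> x; rewrite MD => -[cDx _].
have sub : D `<=` [set x : vec | `|x| <= `|B| + 1].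
  by move=> y Dy /=; apply: HB => //; apply: le_lt_trans (ler_norm _) _; rewrite ltrDl.
by have := closure_subset sub cDx; rewrite -(closure_id _).1//; exact: closed_norm_le.
Qed.

Lemma exit_ray (x v : vec) : D x -> v != 0 -> exists2 t : R, 0 < t & M (x + t *: v).
Proof.
move=> Dx v0; have [B [_ HB]] := D_bounded.
pose r := (`|B| + 1 + `|x| + 1) / `|v|.
have nv : 0 < `|v| by rewrite normr_gt0.
have r0 : 0 < r by rewrite divr_gt0// ltr_wpDl// !addr_ge0.
have [|t /andP[t0 t1]] := @exit_segment x (r *: v) Dx.
  have B1 : B < `|B| + 1 by rewrite ltr_pwDr// ler_norm.
  move=> /(HB _ B1) /=; apply/negP; rewrite -ltNge.
  have := ler_normB (x + r *: v) x; rewrite addrAC subrr add0r normrZ (gtr0_norm r0).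
  rewrite /r mulfVK ?gt_eqF//; lra.
by rewrite scalerA => Mt; exists (t * r) => //; rewrite mulr_gt0.
Qed.

Lemma exists_nonzero : exists v : vec, v != 0.
Proof.
exists (const_mx 1); apply/eqP => /rowP/(_ (lshift d (Ordinal d_gt0))).
by rewrite !mxE => /eqP; rewrite oner_eq0.
Qed.

(** A line through x meets M in both directions. In one of them g does not decrease to first order,
    so g x <= c by convexity; equality would put x on M. *)
Lemma D_lt x : D x -> g x < c.
Proof.
move=> Dx; have [v v0] := exists_nonzero.
have [t t0 /MP Mt] := exit_ray Dx v0.
have [|s s0 /MP Ms] := @exit_ray x (- v) Dx; first by rewrite oppr_eq0.
rewrite lt_def; apply/andP; split.
  by apply/eqP => /esym/MP; exact: D_not_M.
have := convex_tangent x (x + t *: v); have := convex_tangent x (x + s *: - v).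
rewrite Mt Ms !(addrC x) !addrK !dotpZr dotpNr.
have [p|p] := leP 0 (dotp (grad x) v).
  have := mulr_ge0 (ltW t0) p; lra.
have := mulr_gt0 s0 (_ : 0 < - dotp (grad x) v); rewrite oppr_gt0 => /(_ p); lra.
Qed.

Lemma g0_lt : g 0 < c. Proof. exact: D_lt. Qed.

(* Compare the slopes of g along the segment before and after its point on M. *)
Lemma segment_slope (y : vec) (s : R) : 0 < s <= 1 -> g (s *: y) = c ->
  (1 - s) * (c - g 0) <= g y - c.
Proof.
move=> /andP[s0 s1] gs.
have := convex_tangent (s *: y) y; have := convex_tangent (s *: y) 0.
rewrite sub0r dotpNr gs.
have -> : y - s *: y = (1 - s) *: y by rewrite scalerBl scale1r.
rewrite !dotpZr; set p := dotp _ _ => h1 h2.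
have p0 : c - g 0 <= p.
  have p0 : 0 <= p.
    have h : 0 <= s * p by have := g0_lt; lra.
    by rewrite -(pmulr_rge0 _ s0).
  have := ler_wpM2r p0 s1; lra.
have := ler_wpM2l (_ : 0 <= 1 - s) p0; rewrite subr_ge0 => /(_ s1); lra.
Qed.

(** If x were outside D, the segment from 0 to x would meet M, and [segment_slope] would force c <=
    g x. *)
Lemma lt_D x : g x < c -> D x.
Proof.
move=> gx; apply: contrapT => nD.
have [|t t01] := @exit_segment 0 x D0; first by rewrite add0r.
rewrite add0r => /MP Mt.
have := segment_slope t01 Mt; have := g0_lt.
have /andP[t0 t1] := t01.
move=> h1 h2.
have := @mulr_ge0 _ (1 - t) (c - g 0); rewrite !subr_ge0 (ltW h1) t1 => /(_ isT isT); lra.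
Qed.

Lemma grad_pos q : M q -> 0 < dotp (grad q) q.
Proof.
move=> /MP gq; have := convex_tangent q 0; rewrite sub0r dotpNr gq.
have := g0_lt; lra.
Qed.

Lemma grad_neq0 q : M q -> grad q != 0.
Proof. by move=> /grad_pos; apply: contraTneq => ->; rewrite dotp0l ltxx. Qed.

(** * Tangent spaces and the Reeb vector *)

Lemma is_derive_dotp (w : vec) (gam : R -> vec) (t : R) (v : vec) :
  is_derive t (1 : R) gam v ->
  is_derive t (1 : R) (fun s => dotp w (gam s)) (dotp w v).
Proof.
move=> [dg gv].
have -> : (fun s => dotp w (gam s)) = \sum_i (w 0 i *: (fun s => gam s 0 i) : R -> R).
  by apply/funext => s; rewrite fct_sumE.
have dgi i : derivable (fun s => gam s 0 i) t 1 by exact: (derivable_mxP _ _ _).1.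
have -> : dotp w v = \sum_i w 0 i *: 'D_1 (fun s => gam s 0 i) t.
  by apply: eq_bigr => i _; rewrite -gv derive_mx// mxE.
apply: is_derive_sum => i; apply: is_deriveZ; exact/derivableP.
Qed.

(** Convexity of g makes <grad q, gam(t) - q> nonpositive along a curve in M, so this linear
    function of gam(t) is maximal at t = 0. *)
Lemma tangent_orth q v : M q -> tangent M q v -> dotp (grad q) v = 0.
Proof.
move=> Mq [gam [Mgam gam0 dgam gam']].
have dd : is_derive (0 : R) (1 : R) gam v by split.
apply: (derive_at_max_eq0 (is_derive_dotp (grad q) dd)) => t.
rewrite gam0 -subr_le0 -dotpBr.
have := convex_tangent q (gam t).
rewrite ((MP _).1 (Mgam t)) ((MP _).1 Mq); lra.
Qed.

(** The curve is the radial projection s(t) (q + t v) of the tangent line to M; it exists for every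
    t since g >= c on that line. By [segment_slope], 1 - s(t) is at most (g(q + t v) - c) / (c - g
    0), which vanishes to first order at 0. *)
Lemma orth_tangent q v : M q -> dotp (grad q) v = 0 -> tangent M q v.
Proof.
move=> Mq qv; have gq := (MP _).1 Mq.
have gy t : c <= g (q + t *: v).
  have := convex_tangent q (q + t *: v).
  by rewrite (addrC q) addrK dotpZr qv mulr0 addr0 gq.
have ex t : exists s : R, 0 < s <= 1 /\ M (s *: (q + t *: v)).
  have [|s s01] := @exit_segment 0 (q + t *: v) D0.
    by rewrite add0r => /D_lt; rewrite ltNge gy.
  by rewrite add0r => Ms; exists s.
pose s t := sval (cid (ex t)).
have s01 t : 0 < s t <= 1 by exact: (svalP (cid (ex t))).1.
have Ms t : M (s t *: (q + t *: v)) by exact: (svalP (cid (ex t))).2.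
have cg : 0 < c - g 0 by rewrite subr_gt0; exact: g0_lt.
pose phi (t : R) := g (q + t *: v) + - c.
have sphi t : `|1 - s t| <= (c - g 0)^-1 * `|phi t|.
  have /andP[_ s1] := s01 t.
  rewrite ler_pdivlMl// !ger0_norm ?subr_ge0// mulrC.
  exact: segment_slope (s01 t) ((MP _).1 (Ms t)).
have phi0 : phi 0 = 0 by rewrite /phi scale0r addr0 gq subrr.
have dphi : is_derive (0 : R) (1 : R) phi 0.
  have := @is_derive_line _ _ _ g q v 0 (g1.1 _ _).
  rewrite scale0r addr0 derive_grad qv => dl.
  by rewrite -[X in is_derive _ _ _ X]addr0; apply: is_deriveD.
have s0 : s 0 = 1.
  by have := sphi 0; rewrite phi0 normr0 mulr0 normr_le0 subr_eq0 => /eqP.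
exists (fun t => s t *: (q + t *: v)).
have gam0 : s 0 *: (q + 0 *: v) = q by rewrite s0 scale0r addr0 scale1r.
have [dgam gam'] : is_derive (0 : R) (1 : R) (fun t => s t *: (q + t *: v)) v.
  apply: (@is_derive_tangent _ _ _ v phi 0 ((c - g 0)^-1 * (`|q| + `|v|))) => // t.
  rewrite gam0 subr0 => t1.
  have -> : s t *: (q + t *: v) - q - t *: v = - ((1 - s t) *: (q + t *: v)).
    by rewrite scalerBl scale1r opprB -addrA -opprD.
  rewrite normrN normrZ mulrAC; apply: ler_pM => //.
  apply: le_trans (ler_normD _ _) _; rewrite lerD2l normrZ.
  by apply: ler_piMl => //; exact: ltW.
by split.
Qed.

(** The component z of w orthogonal to grad q is tangent, so w, and with it z, is orthogonal to
    z. *)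
Lemma normal_colinear q w : M q -> (forall v, tangent M q v -> dotp w v = 0) ->
  exists mu : R, w = mu *: grad q.
Proof.
move=> Mq Hw; pose mu := dotp w (grad q) / dotp (grad q) (grad q).
exists mu; apply/eqP; rewrite -subr_eq0 -dotp_eq0; apply/eqP.
set z := w - _.
have qz : dotp (grad q) z = 0.
  rewrite /z dotpBr dotpZr /mu divfK ?dotp_eq0 ?grad_neq0//.
  by rewrite (dotpC w) subrr.
have := Hw _ (orth_tangent Mq qz) => wz.
by rewrite {1}/z dotpBl wz dotpZl qz mulr0 subrr.
Qed.

(** The first Reeb condition says that J r is normal to M, so r is a multiple of J grad q; the
    second one fixes the factor. *)
Lemma reebE q : M q -> reeb M q = (dotp (grad q) q)^-1 *: Jc (grad q).
Proof.
move=> Mq; have gp := grad_pos Mq.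
apply: xget_unique.
  split=> [v /(tangent_orth Mq) qv|].
    by rewrite /omega dotpZr dotpJJ (dotpC v) qv mulr0.
  by rewrite /omega dotpZr dotpJJ (dotpC q) mulVf ?gt_eqF.
move=> r [Hr r1].
have [|mu Jr] := @normal_colinear q (Jc r) Mq.
  move=> v /Hr; rewrite /omega dotpJ => /eqP; rewrite oppr_eq0 => /eqP.
  by rewrite dotpC.
have rE : r = - mu *: Jc (grad q) by rewrite -[r]opprK -(JcK r) Jr JcZ scaleNr.
move: r1; rewrite rE /omega dotpZr dotpJJ (dotpC q) => r1.
by congr (_ *: _); rewrite -[LHS](mulfK (lt0r_neq0 gp)) r1 mul1r.
Qed.

(** * The Gauss map and its inverse *)

Definition normal (q : vec) : vec := (enorm (grad q))^-1 *: grad q.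

Lemma grad_normal q : M q -> grad q = enorm (grad q) *: normal q.
Proof.
by move=> /grad_neq0 n0; rewrite scalerA mulfV ?enorm_eq0// scale1r.
Qed.

Lemma gaussE q : M q -> gauss M D q = normal q.
Proof.
move=> Mq; have gq := (MP _).1 Mq.
have n0 := grad_neq0 Mq; have e0 : 0 < enorm (grad q) by rewrite enorm_gt0.
apply: xget_unique.
  split.
  - exact: enorm_unit.
  - by move=> v /(tangent_orth Mq) qv; rewrite dotpZl qv mulr0.
  - exists 1 => // t /andP[t0 _] /D_lt; apply/negP; rewrite -leNgt.
    have := convex_tangent q (q + t *: normal q).
    rewrite gq (addrC q) addrK dotpZr dotpZr => h; apply: le_trans h.
    by rewrite lerDl mulr_ge0 ?(ltW t0)// mulr_ge0 ?invr_ge0 ?(ltW e0)// dotp_ge0.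
move=> nu [nu1 Hnu [e e_gt0 He]].
have [mu nuE] := normal_colinear Mq Hnu.
have amu : `|mu| = (enorm (grad q))^-1.
  by move: nu1; rewrite nuE enormZ => h; rewrite -[LHS](mulfK (lt0r_neq0 e0)) h mul1r.
rewrite nuE /normal; congr (_ *: _).
have [mu0|mu0] := leP 0 mu; first by rewrite -amu ger0_norm.
(* With a negative factor g would decrease to first order along nu, so q + t nu would lie in D for
   small t. *)
exfalso.
have neg : dotp (grad q) nu < 0.
  by rewrite nuE dotpZr nmulr_rlt0// lt_def dotp_ge0 dotp_eq0 n0.
pose ee := - dotp (grad q) nu / 2.
have ee0 : 0 < ee by rewrite divr_gt0// oppr_gt0.
have [del del0 Hdel] := line_quotient_near ee0 (g1.1 q nu).
pose t := Num.min e del / 2.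
have m0 : 0 < Num.min e del by rewrite lt_min e_gt0.
have t0 : 0 < t by rewrite divr_gt0.
have [te td] : t < e /\ t < del.
  by apply/andP; rewrite -lt_min /t; lra.
apply: (He t); rewrite ?t0 ?te//; apply: lt_D.
have := Hdel t; rewrite t0 td => /(_ isT) /ler_normlP[_].
rewrite derive_grad gq /ee => h.
have := mulr_gt0 ee0 t0; rewrite /ee; lra.
Qed.


Lemma normal_unit q : M q -> enorm (normal q) = 1.
Proof. by move=> /grad_neq0; exact: enorm_unit. Qed.

Lemma normal_support q q' : M q -> M q' -> dotp q' (normal q) <= dotp q (normal q).
Proof.
move=> Mq Mq'; have := convex_tangent q q'.
rewrite ((MP _).1 Mq) ((MP _).1 Mq') gerDl {1}(grad_normal Mq) dotpZl.
rewrite pmulr_rle0 ?enorm_gt0 ?grad_neq0// dotpC dotpBl subr_le0; exact.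
Qed.

Lemma normal_pos q : M q -> 0 < dotp q (normal q).
Proof.
move=> Mq; rewrite dotpZr mulr_gt0 ?invr_gt0 ?enorm_gt0 ?grad_neq0//.
by rewrite dotpC grad_pos.
Qed.

Lemma dotp_continuous (w : vec) : continuous (dotp w).
Proof.
apply: continuous_sum => i x.
apply: (@continuousM R _ (cst (w 0 i)) (fun x : vec => x 0 i : R)).
  exact: cst_continuous.
exact: coord_continuous.
Qed.

Lemma M_compact : compact M.
Proof.
have [B _ MB] := M_bounded.
apply: (@subclosed_compact _ _ [set x : vec | `|x| <= B]) => //.
  rewrite Mg; have -> : [set x | g x = c] = g @^-1` [set r | r = c] by [].
  by apply: closed_comp; [move=> x _; exact: g_cont|exact: closed_eq].
exact: compact_norm_le.
Qed.

Lemma M_nonempty : M !=set0.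
Proof.
have [v v0] := exists_nonzero; have [t _ Mt] := exit_ray D0 v0.
by exists (0 + t *: v).
Qed.

(** At a maximum point q of <u, .> on M, u annihilates the tangent vectors and is thus a multiple of
    grad q. The maximum is positive because the ray of u meets M, which makes the factor
    positive. *)
Lemma normal_surjective u : enorm u = 1 -> exists2 q, M q & normal q = u.
Proof.
move=> u1; have u0 : u != 0 by rewrite -enorm_gt0 u1.
have [|q] := EVT_max_rV M_nonempty M_compact (f := dotp u).
  by apply: continuous_subspaceT => x; exact: dotp_continuous.
rewrite inE => Mq qmax; exists q => //.
have [|mu uE] := @normal_colinear q u Mq.
  move=> v [gam [Mgam gam0 dgam gam']].
  have dd : is_derive (0 : R) (1 : R) gam v by split.
  apply: (derive_at_max_eq0 (is_derive_dotp u dd)) => t.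
  by rewrite gam0; apply: qmax; rewrite inE.
have [t t0] := exit_ray D0 u0; rewrite add0r => Mt.
have := qmax (t *: u); rewrite inE => /(_ Mt).
rewrite dotpZr -sqr_enorm u1 expr1n mulr1 => /(lt_le_trans t0).
rewrite uE dotpZl => mup.
have mu0 : 0 < mu by rewrite -(pmulr_lgt0 _ (grad_pos Mq)).
rewrite /normal; congr (_ *: _); move: u1; rewrite uE enormZ gtr0_norm// => u1.
by rewrite -[LHS]mul1r -u1 mulfK ?enorm_eq0 ?grad_neq0.
Qed.

(* Strong convexity of g makes the gradient strongly monotone, and the gradients
   are bounded on M; hence the Gauss map expands distances by a definite factor. *)
Lemma normal_expanding : exists2 L : R, 0 < L &
  forall q q', M q -> M q' -> enorm (q - q') <= L * enorm (normal q - normal q').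
Proof.
have [B _ MB] := M_bounded.
have [m m0 Hm] := strong_convexity_constant g1 g2 B g_hess.
have n0 : 0 < (d + d)%:R :> R by rewrite ltr0n addn_gt0 d_gt0.
(* The division by n^2, n = d + d, turns the sup-norm convexity constant into a Euclidean one. *)
pose k := m / (d + d)%:R ^+ 2.
have k0 : 0 < k by rewrite divr_gt0// exprn_gt0.
have conv q q' : M q -> M q' ->
    dotp (grad q) (q' - q) + k * enorm (q' - q) ^+ 2 / 2 <= 0.
  move=> Mq Mq'.
  have := @taylor2_ge R _ g q (q' - q) (k * enorm (q' - q) ^+ 2)
    g1.1 (fun a v => (g2 v).1 a v).
  rewrite derive_grad subrKC ((MP _).1 Mq) ((MP _).1 Mq') -addrA gerDl; apply.
  move=> t /andP[t0 t1]; apply: le_trans (Hm _ _ _).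
    rewrite /k mulrAC ler_pdivrMr ?exprn_gt0// -mulrA ler_pM2l// -exprMn mulrC.
    by rewrite ler_pXn2r ?nnegrE ?enorm_ge0 ?mulr_ge0// enorm_le_norm.
  have -> : q + t *: (q' - q) = (1 - t) *: q + t *: q'.
    by rewrite scalerBr scalerBl scale1r -addrA (addrC (- _)).
  apply: le_trans (ler_normD _ _) _; rewrite !normrZ !ger0_norm ?subr_ge0//.
  have h1 := ler_wpM2l (_ : 0 <= 1 - t) (MB _ Mq).
  have h2 := ler_wpM2l t0 (MB _ Mq').
  rewrite subr_ge0 in h1; have := h1 t1; lra.
have cgrad : continuous (fun x => dotp (grad x) (grad x)).
  have -> : (fun x => dotp (grad x) (grad x)) =
      (fun x => \sum_i 'D_(delta_mx 0 i) g x * 'D_(delta_mx 0 i) g x).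
    by apply/funext => x; apply: eq_bigr => i _; rewrite !mxE.
  apply: continuous_sum => i x.
  by apply: (@continuousM R _ ('D_(delta_mx 0 i) g) ('D_(delta_mx 0 i) g)); exact: g1.2.
have [q0] := EVT_max_rV M_nonempty M_compact (continuous_subspaceT cgrad).
rewrite inE => Mq0 Hq0.
pose Lam := enorm (grad q0).
have Lam0 : 0 < Lam by rewrite enorm_gt0 grad_neq0.
have LamP q : M q -> enorm (grad q) <= Lam.
  move=> Mq; rewrite -(@ler_pXn2r _ 2)// ?nnegrE ?enorm_ge0//.
  by rewrite !sqr_enorm; apply: Hq0; rewrite inE.
have conv' q q' : M q -> M q' ->
    dotp (normal q) (q' - q) + k / Lam * enorm (q' - q) ^+ 2 / 2 <= 0.
  move=> Mq Mq'; have e0 : 0 < enorm (grad q) by rewrite enorm_gt0 grad_neq0.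
  have := conv q q' Mq Mq'; rewrite {1}(grad_normal Mq) dotpZl => h.
  set E := enorm (q' - q) in h *.
  rewrite -(pmulr_rle0 _ e0) mulrDr; apply: le_trans h; rewrite lerD2l.
  have -> : enorm (grad q) * (k / Lam * E ^+ 2 / 2) =
      (k * E ^+ 2 / 2) * (enorm (grad q) / Lam) by field; rewrite gt_eqF.
  apply: ler_piMr; last by rewrite ler_pdivrMr// mul1r LamP.
  by rewrite divr_ge0// mulr_ge0 ?sqr_ge0// ltW.
clearbody k Lam; exists (Lam / k); first by rewrite divr_gt0.
move=> q q' Mq Mq'.
(* The sum of the two inequalities bounds (k/Lam) |q - q'|^2 by <normal q - normal q', q - q'>, and
   Cauchy-Schwarz cancels one factor |q - q'|. *)
have h1 := conv' q q' Mq Mq'; have h2 := conv' q' q Mq' Mq.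
have [->|qq'] := eqVneq q q'.
  by rewrite subrr enorm0 mulr_ge0 ?enorm_ge0// divr_ge0// ltW.
have e0 : 0 < enorm (q - q') by rewrite enorm_gt0 subr_eq0.
have cs := cauchy_schwarz (normal q - normal q') (q - q').
rewrite -[Lam / k]invf_div ler_pdivlMl ?divr_gt0//.
rewrite -(ler_pM2r e0) -mulrA -expr2; apply: le_trans cs.
move: h1 h2; rewrite (enormBC q') -(opprB q q') dotpNr dotpBl.
set E := k / Lam * _; lra.
Qed.

Lemma normal_inj q q' : M q -> M q' -> normal q = normal q' -> q = q'.
Proof.
move=> Mq Mq' qq'; have [L _ /(_ q q' Mq Mq')] := normal_expanding.
rewrite qq' subrr enorm0 mulr0 => h; apply/eqP; rewrite -subr_eq0 -enorm_eq0.
by rewrite eq_le h enorm_ge0.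
Qed.

Lemma gauss_invP u : enorm u = 1 ->
  M (gauss_inv M D u) /\ normal (gauss_inv M D u) = u.
Proof.
move=> u1; have [q Mq qu] := normal_surjective u1.
have : [set q | M q /\ gauss M D q = u] !=set0 by exists q; rewrite /= gaussE.
by move=> /(@xgetPex _ 0)[Mi]; rewrite gaussE.
Qed.

Lemma gauss_invK q : M q -> gauss_inv M D (normal q) = q.
Proof.
move=> Mq; have [Mi Hi] := gauss_invP (normal_unit Mq).
exact: normal_inj.
Qed.

(** The Reeb vector is a positive multiple of J grad m; applying -J to m - x ~ J grad m gives J(x -
    m) ~ grad m. *)
Lemma sim_reebP (x m : vec) : M m -> sim (m - x) (reeb M m) <->
  x != m /\ normal m = (enorm (x - m))^-1 *: Jc (x - m).
Proof.
move=> Mm; have n0 := grad_neq0 Mm; have gp := grad_pos Mm.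
have e0 : 0 < enorm (grad m) by rewrite enorm_gt0.
rewrite reebE//; split=> [[l l0 E]|[xm E]].
  pose k := l / dotp (grad m) m.
  have k0 : 0 < k by rewrite divr_gt0.
  have xE : x - m = - (k *: Jc (grad m)) by rewrite -opprB E scalerA.
  split.
    rewrite -subr_eq0 xE oppr_eq0 scaler_eq0 gt_eqF//= -enorm_eq0 enormJ.
    by rewrite enorm_eq0.
  rewrite xE enormN enormZ enormJ JcN JcZ JcK !scalerN opprK scalerA gtr0_norm//.
  by rewrite invfM mulrAC mulVf ?gt_eqF// mul1r.
have e1 : 0 < enorm (x - m) by rewrite enorm_gt0 subr_eq0.
exists (dotp (grad m) m * enorm (x - m) / enorm (grad m)).
  by rewrite divr_gt0// mulr_gt0.
have JE : Jc (grad m) = (enorm (grad m) / enorm (x - m)) *: (m - x).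
  by rewrite {1}(grad_normal Mm) E !JcZ JcK scalerA opprB.
rewrite JE !scalerA -[LHS]scale1r; congr (_ *: _).
by field; rewrite !gt_eqF.
Qed.

Lemma sim_reeb_gauss_inv (x m : vec) : M m /\ sim (m - x) (reeb M m) <->
  x - m != 0 /\ m = gauss_inv M D ((enorm (x - m))^-1 *: Jc (x - m)).
Proof.
rewrite subr_eq0; split=> [[Mm /(sim_reebP x Mm)[xm <-]]|[xm mE]].
  by rewrite gauss_invK.
have u1 : enorm ((enorm (x - m))^-1 *: Jc (x - m)) = 1.
  rewrite enormZ enormJ ger0_norm ?invr_ge0 ?enorm_ge0//.
  by rewrite mulVf// enorm_eq0 subr_eq0.
have := gauss_invP u1; rewrite -mE => -[Mm nE].
by split => //; apply/(sim_reebP x Mm).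
Qed.

(** These properties of the inverse Gauss map are the input for the dynamics far from M; the last
    two express that <N(u), u> is the support function of M and is positive. *)
Theorem gauss_inv_spec : exists B L : R, [/\ 0 < B, 0 < L,
  forall u, enorm u = 1 -> enorm (gauss_inv M D u) <= B,
  forall u u', enorm u = 1 -> enorm u' = 1 ->
    enorm (gauss_inv M D u - gauss_inv M D u') <= L * enorm (u - u') &
  (forall u u', enorm u = 1 -> enorm u' = 1 ->
    dotp (gauss_inv M D u') u <= dotp (gauss_inv M D u) u) /\
  (forall u, enorm u = 1 -> 0 < dotp (gauss_inv M D u) u)].
Proof.
have [B B0 MB] := M_bounded; have [L L0 HL] := normal_expanding.
exists ((d + d)%:R * B), L; split => //.
- by rewrite mulr_gt0// ltr0n addn_gt0 d_gt0.
- move=> u /gauss_invP[Mu _]; apply: le_trans (enorm_le_norm _) _.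
  by apply: ler_wpM2l => //; exact: MB.
- move=> u u' /gauss_invP[Mu nu] /gauss_invP[Mu' nu'].
  by rewrite -{2}nu -{2}nu'; exact: HL.
- split=> [u u' /gauss_invP[Mu nu] /gauss_invP[Mu' _]|u /gauss_invP[Mu nu]].
    by rewrite -{1 3}nu; exact: normal_support.
  by rewrite -{2}nu; exact: normal_pos.
Qed.

End Hypersurface.

(** * Size and variation of n_- and V away from the origin *)

Section FarDynamics.
Variables (R : realType) (d : nat).
Local Notation vec := (vec R d).
Variables (N : vec -> vec) (B L : R).
Hypotheses (B0 : 0 < B) (L0 : 0 < L) (d_gt0 : (0 < d)%N).
Hypothesis N_bound : forall u, enorm u = 1 -> enorm (N u) <= B.
Hypothesis N_lip : forall u u', enorm u = 1 -> enorm u' = 1 ->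
  enorm (N u - N u') <= L * enorm (u - u').
Hypothesis N_support : forall u u', enorm u = 1 -> enorm u' = 1 ->
  dotp (N u') u <= dotp (N u) u.
Hypothesis N_pos : forall u, enorm u = 1 -> 0 < dotp (N u) u.
Implicit Types x y : vec.

Definition nm x : vec := N ((enorm x)^-1 *: Jc x).
Definition vfield x : vec := 2 *: (nm (- x) - nm x).

Lemma enorm_unitJ x : x != 0 -> enorm ((enorm x)^-1 *: Jc x) = 1.
Proof.
move=> x0; rewrite enormZ enormJ ger0_norm ?invr_ge0 ?enorm_ge0//.
by rewrite mulVf// enorm_eq0.
Qed.

Lemma nm_bound x : x != 0 -> enorm (nm x) <= B.
Proof. by move=> /enorm_unitJ; exact: N_bound. Qed.

Lemma nm_lip x y : x != 0 -> y != 0 ->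
  enorm (nm x - nm y) <= 2 * L * enorm (x - y) / enorm x.
Proof.
move=> x0 y0; apply: le_trans (N_lip (enorm_unitJ x0) (enorm_unitJ y0)) _.
rewrite -!JcZ -JcB enormJ (mulrC 2) -!mulrA ler_pM2l// !mulrA.
exact: enorm_unit_dist.
Qed.

Lemma vfield_bound x : x != 0 -> enorm (vfield x) <= 4 * B.
Proof.
move=> x0; rewrite enormZ ger0_norm//.
have := enormB (nm (- x)) (nm x); have := nm_bound x0.
have := @nm_bound (- x); rewrite oppr_eq0 => /(_ x0); lra.
Qed.

Lemma vfield_lip x y : x != 0 -> y != 0 ->
  enorm (vfield x - vfield y) <= 8 * L * enorm (x - y) / enorm x.
Proof.
move=> x0 y0; rewrite -scalerBr enormZ ger0_norm//.
have -> : nm (- x) - nm x - (nm (- y) - nm y) =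
    nm (- x) - nm (- y) - (nm x - nm y).
  by apply/rowP => i; rewrite !mxE; ring.
have := enormB (nm (- x) - nm (- y)) (nm x - nm y).
have := nm_lip x0 y0.
have := @nm_lip (- x) (- y); rewrite !oppr_eq0 => /(_ x0 y0).
rewrite -opprD !enormN.
set E := enorm (x - y) / enorm x.
rewrite -!(mulrA _ (enorm (x - y))) -/E; lra.
Qed.

(** * The Hamiltonian of V and its conservation *)

Definition supp x : R := dotp (nm x) (Jc x).
Definition ham x : R := supp x + supp (- x).

Lemma dotpJr0 x : dotp x (Jc (0 : vec)) = 0.
Proof. by rewrite -(scale0r (0 : vec)) JcZ scale0r dotp0r. Qed.

Lemma supp0 : supp 0 = 0.
Proof. exact: dotpJr0. Qed.

Lemma JcE x : x != 0 -> Jc x = enorm x *: ((enorm x)^-1 *: Jc x).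
Proof. by move=> x0; rewrite scalerA mulfV ?scale1r// enorm_eq0. Qed.

Lemma supp_gt0 x : x != 0 -> 0 < supp x.
Proof.
move=> x0; rewrite /supp {1}(JcE x0) dotpZr mulr_gt0 ?enorm_gt0//.
exact/N_pos/enorm_unitJ.
Qed.

Lemma supp_ge x y : x != 0 -> dotp (nm x) (Jc y) <= supp y.
Proof.
move=> x0; have [->|y0] := eqVneq y 0; first by rewrite supp0 dotpJr0.
rewrite /supp (JcE y0) !(dotpZr (enorm y)) ler_pM2l ?enorm_gt0//.
by apply: N_support; exact: enorm_unitJ.
Qed.

Lemma supp_lip x y : supp y - supp x <= B * enorm (y - x).
Proof.
have [->|y0] := eqVneq y 0.
  rewrite supp0 sub0r; apply: (@le_trans _ _ 0).
    rewrite oppr_le0; have [->|/supp_gt0/ltW//] := eqVneq x 0.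
    by rewrite supp0.
  by rewrite mulr_ge0 ?enorm_ge0// ltW.
have := supp_ge x y0; have := cauchy_schwarz (nm y) (Jc (y - x)).
have := ler_wpM2r (enorm_ge0 (y - x)) (nm_bound y0).
rewrite enormJ JcB dotpBr -/(supp y); lra.
Qed.

(** The function [supp] is x -> h(Jx), h the support function. The support inequality at x makes the
    remainder nonnegative, and the one at y bounds it by <nm y - nm x, J(y - x)>, which is quadratic
    by [nm_lip]. The case y = 0 is separate since [nm] has no meaning there. *)
Lemma supp_expand x y : x != 0 ->
  `|supp y - supp x - dotp (nm x) (Jc (y - x))| <= 2 * L * enorm (y - x) ^+ 2 / enorm x.
Proof.
move=> x0; rewrite JcB dotpBr -/(supp x) opprB addrA subrK ger0_norm; last first.
  by rewrite subr_ge0; exact: supp_ge.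
have [->|y0] := eqVneq y 0.
  rewrite supp0 dotpJr0 subrr divr_ge0 ?enorm_ge0//.
  by rewrite !mulr_ge0 ?exprn_ge0 ?enorm_ge0// ltW.
have h1 := supp_ge x y0.
have h2 := cauchy_schwarz (nm y - nm x) (Jc (y - x)).
have h3 := ler_wpM2r (enorm_ge0 (y - x)) (nm_lip x0 y0).
rewrite enormJ (enormBC x y) in h2 h3; rewrite (enormBC (nm x)) in h3.
have h4 := le_trans h2 h3.
rewrite (_ : 2 * L * enorm (y - x) / enorm x * enorm (y - x) =
  2 * L * enorm (y - x) ^+ 2 / enorm x) in h4; last by ring.
apply: le_trans h4; rewrite JcB dotpBr !dotpBl.
by move: h1; rewrite /supp; lra.
Qed.

Lemma ham0 : ham 0 = 0.
Proof. by rewrite /ham oppr0 supp0 addr0. Qed.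

Lemma ham_gt0 x : x != 0 -> 0 < ham x.
Proof. by move=> x0; rewrite addr_gt0// supp_gt0 ?oppr_eq0. Qed.

Lemma ham_ge0 x : 0 <= ham x.
Proof. by have [->|/ham_gt0/ltW//] := eqVneq x 0; rewrite ham0. Qed.

Lemma ham_lip x y : `|ham y - ham x| <= 2 * B * enorm (y - x).
Proof.
have h1 := supp_lip x y; have h2 := supp_lip y x.
have h3 := supp_lip (- x) (- y); have h4 := supp_lip (- y) (- x).
rewrite -opprD enormN in h3; rewrite -opprD enormN in h4.
rewrite (enormBC x) in h2 h4.
rewrite ler_norml /ham; apply/andP; split; lra.
Qed.

Lemma ham_le x : ham x <= 2 * B * enorm x.
Proof.
by have := ham_lip 0 x; rewrite ham0 !subr0; apply: le_trans; exact: ler_norm.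
Qed.

Definition ham_grad x : vec := - Jc (nm x - nm (- x)).

Lemma ham_expand x y : x != 0 ->
  `|ham y - ham x - dotp (ham_grad x) (y - x)| <= 4 * L * enorm (y - x) ^+ 2 / enorm x.
Proof.
move=> x0; rewrite dotpNl dotpJ opprK dotpBl.
have := @supp_expand (- x) (- y); rewrite oppr_eq0 => /(_ x0).
rewrite -opprD !enormN JcN dotpNr.
have := supp_expand y x0; rewrite /ham.
set a := supp x; set b := supp y; set a' := supp (- x); set b' := supp (- y).
set p := dotp _ _; set q := dotp _ _ => h1 h2.
have -> : b + b' - (a + a') - (p - q) = (b - a - p) + (b' - a' - - q) by ring.
apply: le_trans (ler_normD _ _) _; move: (lerD h1 h2).
set e := enorm (y - x) ^+ 2; rewrite -!(mulrA _ e); lra.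
Qed.

(** The gradient of H is J V / 2, and J V is orthogonal to V. *)
Lemma ham_grad_orth x : dotp (ham_grad x) (vfield x) = 0.
Proof.
rewrite /ham_grad /vfield -(opprB (nm (- x))) JcN opprK dotpZr.
by rewrite dotpJ0 mulr0.
Qed.

(** Squaring H removes its singularity at 0: the factor [ham x], of order |x|, cancels the 1/|x| in
    the remainder, so the expansion is uniform in x. Conservation can then be proved before
    trajectories are known to avoid 0. *)
Definition energy x : R := ham x ^+ 2.

Lemma energy_expand : exists C : R, forall x y,
  `|energy y - energy x - 2 * ham x * dotp (ham_grad x) (y - x)|
    <= C * enorm (y - x) ^+ 2.
Proof.
exists (4 * B ^+ 2 + 16 * B * L) => x y.
have hl := ham_lip x y.
have sq : (ham y - ham x) ^+ 2 <= 4 * B ^+ 2 * enorm (y - x) ^+ 2.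
  have -> : 4 * B ^+ 2 * enorm (y - x) ^+ 2 = (2 * B * enorm (y - x)) ^+ 2 by ring.
  rewrite -real_normK ?num_real// ler_pXn2r ?nnegrE// !mulr_ge0 ?enorm_ge0//.
  exact: ltW.
set z := dotp _ _.
have -> : energy y - energy x - 2 * ham x * z =
    (ham y - ham x) ^+ 2 + 2 * ham x * (ham y - ham x - z) by rewrite /energy; ring.
apply: le_trans (ler_normD _ _) _; rewrite [leRHS]mulrDl; apply: lerD.
  by rewrite ger0_norm ?sqr_ge0.
have [x0|x0] := eqVneq x 0.
  rewrite {1}x0 ham0 mulr0 mul0r normr0; apply: mulr_ge0; last exact: sqr_ge0.
  have := mulr_gt0 B0 L0; lra.
have ex : 0 < enorm x by rewrite enorm_gt0.
have hx := ham_ge0 x; have he := ham_expand y x0; have hb := ham_le x.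
rewrite normrM ger0_norm; last by rewrite mulr_ge0.
apply: le_trans (ler_wpM2l _ he) _; first by rewrite mulr_ge0.
have -> : 16 * B * L * enorm (y - x) ^+ 2 =
    2 * (2 * B * enorm x) * (4 * L * enorm (y - x) ^+ 2 / enorm x).
  by field; rewrite gt_eqF.
apply: ler_wpM2r; last by rewrite ler_pM2l.
apply: divr_ge0; last exact: enorm_ge0.
by apply: mulr_ge0; [move: L0; lra|exact: sqr_ge0].
Qed.

(** After subtraction of the linear part [dotp A], the energy along [gam] changes by at most C
    |gam(s) - gam(t)|^2, which vanishes to first order at t. If gam(t) = 0, then A = 0 because H
    does. *)
Lemma energy_derive (gam : R -> vec) (t : R) (v : vec) :
  is_derive t (1 : R) gam v -> dotp (ham_grad (gam t)) v = 0 ->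
  is_derive t (1 : R) (energy \o gam) 0.
Proof.
move=> dg orth; have [C HC] := energy_expand.
pose A := 2 * ham (gam t) *: ham_grad (gam t).
have da : is_derive t (1 : R) (fun s => dotp A (gam s)) 0.
  have := is_derive_dotp A dg; by rewrite dotpZl orth mulr0.
pose phi s := dotp (gam s - gam t) (gam s - gam t).
have dphi : is_derive t (1 : R) phi 0.
  have [dgam _] := dg.
  have -> : phi = \sum_i ((fun s => gam s 0 i) - cst (gam t 0 i)) ^+ 2.
    apply/funext => s; rewrite fct_sumE; apply: eq_bigr => i _.
    by rewrite !mxE -expr2.
  have -> : 0 = \sum_(i < d + d) 0 :> R by rewrite big1.
  apply: is_derive_sum => i.
  have di : is_derive t (1 : R) (fun s => gam s 0 i) ('D_1 (fun s => gam s 0 i) t).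
    by apply/derivableP; exact: (derivable_mxP _ _ _).1.
  by apply: is_derive_eq; rewrite !fctE subrr expr0n mulr0 scale0r.
pose f s := energy (gam s) - dotp A (gam s).
have df : is_derive t (1 : R) f 0.
  apply: (@is_derive_tangent _ _ _ _ phi t C) => //.
    by rewrite /phi subrr dotp0l.
  move=> s _; rewrite scaler0 subr0 (ger0_norm (dotp_ge0 _)) -sqr_enorm /f.
  have -> : energy (gam s) - dotp A (gam s) - (energy (gam t) - dotp A (gam t)) =
    energy (gam s) - energy (gam t) - 2 * ham (gam t) *
     dotp (ham_grad (gam t)) (gam s - gam t).
    by rewrite -dotpZl -/A dotpBr; ring.
  exact: HC.
have -> : energy \o gam = f + (fun s => dotp A (gam s)).
  by apply/funext => s; rewrite !fctE /f subrK.
by rewrite -[X in is_derive _ _ _ X]addr0; apply: is_deriveD.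
Qed.

(* Slowing [vfield] down by the factor [ham / ham x0] makes it globally Lipschitz,
   and does not change the trajectory of [x0], on which [ham] is conserved. *)
Lemma vfield_flow x0 : x0 != 0 -> exists gam : R -> vec,
  gam 0 = x0 /\ forall t, gam t != 0 /\ is_derive t (1 : R) gam (vfield (gam t)).
Proof.
move=> x00; have h0 := ham_gt0 x00.
pose W x := (ham x / ham x0) *: vfield x.
(* 16 B L is 2B (growth of H) times 8L (variation of V); 8 B^2 is 2B (Lipschitz constant of H) times
   4B (bound on V). *)
pose K := (16 * B * L + 8 * B ^+ 2) / ham x0.
have K0 : 0 < K by rewrite divr_gt0// addr_gt0 ?mulr_gt0// exprn_gt0.
have W0 : W 0 = 0 by rewrite /W ham0 mul0r scale0r.
have W_le x : enorm (W x) <= K * enorm x.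
  have [->|xn0] := eqVneq x 0; first by rewrite W0 enorm0 mulr0.
  rewrite enormZ ger0_norm ?divr_ge0 ?ham_ge0 ?(ltW h0)//.
  rewrite /K mulrAC [X in _ <= X]mulrAC ler_pM2r ?invr_gt0//.
  apply: le_trans (ler_pM (ham_ge0 x) (enorm_ge0 _) (ham_le x) (vfield_bound xn0)) _.
  have := mulr_gt0 (mulr_gt0 B0 L0) (_ : 0 < enorm x); rewrite enorm_gt0 => /(_ xn0).
  lra.
have W_elip x y : enorm (W x - W y) <= K * enorm (x - y).
  have [->|xn0] := eqVneq x 0; first by rewrite W0 !sub0r !enormN.
  have [->|yn0] := eqVneq y 0; first by rewrite W0 !subr0.
  have ex : 0 < enorm x by rewrite enorm_gt0.
  have -> : W x - W y = (ham x0)^-1 *: (ham x *: (vfield x - vfield y)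
      + (ham x - ham y) *: vfield y).
    apply/rowP => i; rewrite /W !mxE; ring.
  rewrite enormZ gtr0_norm ?invr_gt0// /K mulrAC [X in _ <= X]mulrC ler_pM2l ?invr_gt0//.
  apply: le_trans (enormD _ _) _; rewrite (enormZ (ham x)) (enormZ (ham x - ham y)).
  rewrite mulrDl ger0_norm ?ham_ge0//.
  apply: lerD.
    apply: le_trans (ler_pM (ham_ge0 x) (enorm_ge0 _) (ham_le x) (vfield_lip xn0 yn0)) _.
    by rewrite le_eqVlt; apply/orP; left; apply/eqP; field; rewrite gt_eqF.
  apply: le_trans (ler_pM (normr_ge0 _) (enorm_ge0 _) (ham_lip y x) (vfield_bound yn0)) _.
  by rewrite le_eqVlt; apply/orP; left; apply/eqP; ring.
have W_lip x y : `|W x - W y| <= K * (d + d)%:R * `|x - y|.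
  apply: le_trans (norm_le_enorm _) _; apply: le_trans (W_elip x y) _.
  by rewrite -mulrA ler_pM2l// enorm_le_norm.
have KL0 : 0 < K * (d + d)%:R by rewrite mulr_gt0// ltr0n addn_gt0 d_gt0.
have [gam [gam0 dgam]] := lipschitz_flow W_lip x0 KL0.
have cst_energy t : energy (gam t) = energy x0.
  rewrite -gam0; apply: (@is_derive_0_is_cst _ (energy \o gam)) => s.
  apply: energy_derive (dgam s) _.
  by rewrite dotpZr ham_grad_orth mulr0.
have cst_ham t : ham (gam t) = ham x0.
  by have /eqP := cst_energy t; rewrite eqrXn2 ?ham_ge0// => /eqP.
exists gam; split => // t; split.
  (* H keeps its positive initial value, whereas it vanishes at 0. *)
  by apply/eqP => gt0; move: h0; rewrite -(cst_ham t) gt0 ham0 ltxx.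
by have := dgam t; rewrite /W cst_ham mulfV ?gt_eqF// scale1r.
Qed.

Lemma flow_step (gam : R -> vec) :
  (forall t, gam t != 0 /\ is_derive t (1 : R) gam (vfield (gam t))) ->
  enorm (gam 1 - gam 0 - vfield (gam 0)) <=
    32 * B * L * (d + d)%:R ^+ 2 / enorm (gam 0).
Proof.
move=> Hg; have g00 := (Hg 0).1; have e0 : 0 < enorm (gam 0) by rewrite enorm_gt0.
have B4 : 0 <= 4 * B by rewrite mulr_ge0// ltW.
have dcoord i (t : R) : is_derive t (1 : R) (fun s => gam s 0 i) (vfield (gam t) 0 i).
  have [dg gE] := (Hg t).2.
  have dgi : derivable (fun s => gam s 0 i) t 1 by exact: (derivable_mxP _ _ _).1.
  by split => //; rewrite -gE derive_mx// mxE.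
have near_start t : 0 <= t <= 1 -> enorm (gam t - gam 0) <= (d + d)%:R * (4 * B).
  move=> /andP[t0 t1]; apply: le_trans (enorm_le_norm _) _.
  apply: ler_wpM2l => //; apply: norm_rV_le => // i; rewrite !mxE.
  have dh (s : R) : is_derive s (1 : R) (fun s : R => 4 * B * s) (4 * B).
    by apply: is_derive_eq; rewrite [LHS]mulr1.
  have := norm_diff_le_dominated t0 (dcoord i) dh.
  rewrite mulr0 subr0 => H; apply: le_trans (H _) _; last exact: ler_piMr.
  move=> s _; apply: le_trans (coord_le_enorm _ _) _.
  exact: vfield_bound (Hg s).1.
(* P bounds the variation of V on [0, 1], where the curve moves by at most n * 4B, n = d + d. *)
pose P := 8 * L * ((d + d)%:R * (4 * B)) / enorm (gam 0).
have P0 : 0 <= P by rewrite divr_ge0 ?enorm_ge0// !mulr_ge0// ltW.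
have -> : 32 * B * L * (d + d)%:R ^+ 2 / enorm (gam 0) = (d + d)%:R * P.
  by rewrite /P; field; rewrite gt_eqF.
apply: le_trans (enorm_le_norm _) _; apply: ler_wpM2l => //.
apply: norm_rV_le => // i; pose v := vfield (gam 0) 0 i.
have -> : (gam 1 - gam 0 - vfield (gam 0)) 0 i = gam 1 0 i - v - gam 0 0 i.
  by rewrite /v !mxE; ring.
have df (s : R) : is_derive s (1 : R) ((fun s => gam s 0 i) - (fun s : R => v * s))
    (vfield (gam s) 0 i - v).
  have dv : is_derive s (1 : R) (fun s : R => v * s) v.
    by apply: is_derive_eq; rewrite [LHS]mulr1.
  exact: is_deriveB.
have dh (s : R) : is_derive s (1 : R) (fun s : R => P * s) P.
  by apply: is_derive_eq; rewrite [LHS]mulr1.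
have := norm_diff_le_dominated ler01 df dh.
rewrite !fctE !mulr0 !mulr1 !subr0; apply => s s01.
have -> : vfield (gam s) 0 i - v = (vfield (gam s) - vfield (gam 0)) 0 i.
  by rewrite /v !mxE.
apply: le_trans (coord_le_enorm _ _) _; rewrite enormBC.
apply: le_trans (vfield_lip g00 (Hg s).1) _.
rewrite /P ler_pM2r ?invr_gt0// ler_pM2l ?mulr_gt0// enormBC.
exact: near_start.
Qed.

(** * The fixed-point equation for the tangency point *)

Lemma far_sub_neq0 x m : enorm m <= B -> 2 * B <= enorm x ->
  x - m != 0 /\ enorm x <= 2 * enorm (x - m).
Proof.
move=> mB xB; have := enorm_le_dist x m; rewrite -enorm_gt0 => h.
split; move: B0 => b0; lra.
Qed.

Lemma fixed_point_exists x : 2 * B <= enorm x -> 8 * L <= enorm x ->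
  exists2 m, enorm m <= B & m = nm (x - m).
Proof.
move=> xB xL; pose f m := nm (x - m).
have ex : 0 < enorm x by move: B0 => b0; lra.
have fB m : enorm m <= B -> enorm (f m) <= B.
  by move=> mB; apply: nm_bound; have [] := far_sub_neq0 mB xB.
(* On the ball of radius B the Lipschitz constant is 2L/|x - m|, and |x - m| >= |x|/2 >= 4L makes it
   at most 1/2. *)
have f_lip m m' : enorm m <= B -> enorm m' <= B ->
    enorm (f m - f m') <= enorm (m - m') / 2.
  move=> mB mB'; have [n0 hn] := far_sub_neq0 mB xB; have [n0' _] := far_sub_neq0 mB' xB.
  apply: le_trans (nm_lip n0 n0') _.
  have -> : x - m - (x - m') = - (m - m').
    by apply/rowP => i; rewrite !mxE; ring.
  rewrite enormN ler_pdivrMr ?enorm_gt0//.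
  have e0 := enorm_ge0 (m - m').
  have h4 : 4 * L <= enorm (x - m) by lra.
  have := ler_wpM2r e0 h4; lra.
pose u k := iter k f 0.
have uB k : enorm (u k) <= B.
  by elim: k => [|k IH]; [rewrite enorm0 ltW|exact: fB].
pose A := enorm (u 1%N - u 0%N).
have uS k : enorm (u k.+1 - u k) <= A / 2 ^+ k.
  elim: k => [|k IH]; first by rewrite expr0 divr1.
  have h : enorm (u k.+2 - u k.+1) <= enorm (u k.+1 - u k) / 2.
    exact: (f_lip (u k.+1) (u k) (uB _) (uB _)).
  apply: le_trans h _.
  by rewrite exprSr invfM mulrA ler_pM2r// invr_gt0.
have [|l Hl] := @geometric_limit_rV R (d + d) u A.
  by move=> k; apply: le_trans (norm_le_enorm _) (uS k).
pose C := (d + d)%:R * (2 * A).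
have lC k : enorm (l - u k) <= C / 2 ^+ k.
  by apply: le_trans (enorm_le_norm _) _; rewrite /C -mulrA ler_wpM2l.
have lB : enorm l <= B.
  rewrite -subr_le0; apply: (@le0_of_le_geometric _ _ C) => k.
  have := lC k; have := uB k; have := enorm_le_dist l (u k); lra.
exists l => //; apply/eqP; rewrite -subr_eq0 -enorm_eq0 eq_le enorm_ge0 andbT.
apply: (@le0_of_le_geometric _ _ C) => k.
have h1 := lC k.+1; have h2 := f_lip _ _ (uB k) lB; have h3 := lC k.
have := enorm_tri (u k.+1) l (f l).
rewrite (enormBC (u k)) in h2.
have -> : C / 2 ^+ k = C / 2 ^+ k.+1 + C / 2 ^+ k / 2.
  by rewrite exprS; field; rewrite expf_neq0.
rewrite /= -/(u k) in h1 h2 *; lra.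
Qed.

(** * Two steps of the billiard map far from M *)

Variables (mm : vec -> vec) (rho : R).
Hypothesis rho_ge : 2 * B <= rho.
Hypothesis mmP : forall x, rho <= enorm x ->
  enorm (mm x) <= B /\ mm x = nm (x - mm x).
Local Notation T x := (2 *: mm x - x).

Lemma mm_approx x : rho <= enorm x -> enorm (mm x - nm x) <= 2 * L * B / enorm x.
Proof.
move=> xr; have [mB mE] := mmP xr.
have xB := le_trans rho_ge xr; have [n0 _] := far_sub_neq0 mB xB.
have ex : 0 < enorm x by move: B0 => b0; lra.
rewrite {1}mE enormBC; apply: le_trans (nm_lip _ n0) _; first by rewrite -enorm_gt0.
by rewrite subKr ler_pM2r ?invr_gt0// ler_pM2l ?mulr_gt0.
Qed.

(** With y = T x one has T(T x) - x = 2 (mm y - mm x), and y is within 2B of -x. The hypothesis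
    gives |y| >= |x|/2 >= rho, so [mm_approx] applies at y too. The three errors 2LB, 4LB and 4LB,
    doubled, make up 20 B L. *)
Lemma billiard_step x : 2 * rho <= enorm x ->
  enorm (T (T x) - x - vfield x) <= 20 * B * L / enorm x.
Proof.
move=> xr; have b0 := B0; have rg := rho_ge; have r0 : 0 < rho by lra.
have xr' : rho <= enorm x by lra.
have ex : 0 < enorm x by lra.
have x0 : x != 0 by rewrite -enorm_gt0.
have [mB mE] := mmP xr'; pose y := T x.
have yx : enorm (- x - y) <= 2 * B.
  have -> : - x - y = - (2 *: mm x) by apply/rowP => i; rewrite !mxE; ring.
  by rewrite enormN enormZ ger0_norm// ler_pM2l.
have yn : enorm x <= 2 * enorm y.
  by have := enorm_le_dist (- x) y; rewrite enormN; lra.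
have ey : 0 < enorm y by lra.
have y0 : y != 0 by rewrite -enorm_gt0.
have h1 := mm_approx xr'.
have h2 : enorm (mm y - nm y) <= 4 * L * B / enorm x.
  apply: le_trans (mm_approx (_ : rho <= enorm y)) _; first by lra.
  rewrite ler_pdivrMr// [leRHS]mulrAC ler_pdivlMr//.
  have := ler_wpM2l (ltW (mulr_gt0 L0 B0)) yn; lra.
have h3 : enorm (nm (- x) - nm y) <= 4 * L * B / enorm x.
  apply: le_trans (nm_lip _ y0) _; first by rewrite oppr_eq0.
  rewrite enormN ler_pM2r ?invr_gt0//.
  have := ler_wpM2l (ltW L0) yx; lra.
have -> : T (T x) - x - vfield x =
    2 *: ((mm y - nm y) - (nm (- x) - nm y) - (mm x - nm x)).
  rewrite -/y /vfield {2}/y; apply/rowP => i; rewrite !mxE; ring.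
rewrite enormZ ger0_norm//.
have := enormB (mm y - nm y - (nm (- x) - nm y)) (mm x - nm x).
have := enormB (mm y - nm y) (nm (- x) - nm y).
have -> : 20 * B * L / enorm x =
    2 * (4 * L * B / enorm x + 4 * L * B / enorm x + 2 * L * B / enorm x) by ring.
lra.
Qed.

End FarDynamics.

(** * Choice of constants and conclusion *)

Lemma Ck2_C1 (R : realType) (d : nat) (g : vec R d -> R) : Ck 2 g ->
  C1 g /\ forall v, C1 ('D_v g).
Proof.
move=> [_ dg D1]; split.
  by split; [exact: dg|move=> v; case: (D1 v) => cd _ _; exact: cd].
move=> v; case: (D1 v) => _ ddg cdg.
by split; [exact: ddg|move=> w; exact: cdg].
Qed.

Theorem theorem3p4 (R : realType) (d : nat) (M D : set (vec R d)) :
  standing_assumptions M D ->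
  exists2 Delta : R, 0 < Delta &
  exists2 K : R, 0 < K &
  forall x : vec R d, Delta^-1 <= enorm x ->
    enorm (Tmap M (Tmap M x) - time_one M D x) <= K / enorm x.
Proof.
move=> [d0 [Do Db _ D0] MD [g [c [gs gh Mg]]]].
have [gc _ _] := gs 2%N; have [g1 g2] := Ck2_C1 (gs 2%N).
have [B [L [B0 L0 NB NL [NS NP]]]] :=
  gauss_inv_spec d0 Do Db D0 MD Mg gc g1 g2 gh.
have simE := sim_reeb_gauss_inv d0 Do Db D0 MD Mg gc g1 g2 gh.
set N := gauss_inv M D in NB NL NS NP simE.
(* 2B keeps x - m away from 0, and 8L makes the fixed-point map contract. *)
pose rho := 2 * B + 8 * L.
have rho0 : 0 < rho by rewrite addr_gt0// mulr_gt0.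
have mmP x : rho <= enorm x ->
    enorm (m_minus M x) <= B /\ m_minus M x = nm N (x - m_minus M x).
  move=> xr.
  have [||m mB mE] := @fixed_point_exists _ _ N B L B0 L0 NB NL x.
  - by move: xr; rewrite /rho; lra.
  - by move: xr; rewrite /rho; lra.
  have xB : 2 * B <= enorm x by move: xr; rewrite /rho; lra.
  have [n0 _] := far_sub_neq0 B0 mB xB.
  (* The fixed point shows that the set defining [m_minus] is inhabited, so the point chosen by
     [xget] obeys the same equation. *)
  have [|Mm sm] := @xgetPex _ 0 [set m | M m /\ sim (m - x) (reeb M m)].
    by exists m; apply/simE; split.
  have /simE[n1 E1] := conj Mm sm.
  split; last exact: E1.
  by rewrite /m_minus E1; apply: NB; rewrite enormZ enormJ ger0_norm
    ?invr_ge0 ?enorm_ge0// mulVf// enorm_eq0.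
have VE x : Vfield M D x = vfield N x.
  rewrite /Vfield /vfield /n_plus /n_minus /nm -/N; congr (_ *: (N _ - _)).
  by rewrite enormN JcN scalerN.
pose K1 := 32 * B * L * (d + d)%:R ^+ 2.
pose K2 := 20 * B * L.
have K20 : 0 < K2 by rewrite !mulr_gt0.
have K10 : 0 <= K1.
  by rewrite mulr_ge0 ?sqr_ge0// ltW// !mulr_gt0.
exists (2 * rho)^-1; first by rewrite invr_gt0 mulr_gt0.
exists (K1 + K2); first by rewrite ltr_wpDl.
move=> x; rewrite invrK => xr.
have x0 : x != 0 by rewrite -enorm_gt0; lra.
(* Likewise the conserved flow provides one integral curve, and the estimate is applied to the curve
   behind the value chosen by [xget]. *)
have [|gam [gamI gam0 gamE]] := @xgetPex _ 0 [set y | exists gam : R -> vec R d,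
    [/\ is_integral_curve M D gam, gam 0 = x & gam 1 = y]].
  have [gam [gam0 Hgam]] := vfield_flow B0 L0 d0 NB NL NS NP x0.
  exists (gam 1), gam; split => // t; have [gt0 [dg gE]] := Hgam t.
  by split => //; rewrite gE VE.
have Hgam t : gam t != 0 /\ is_derive t (1 : R) gam (vfield N (gam t)).
  by have [gt0 dg gE] := gamI t; split => //; split => //; rewrite gE VE.
have h1 := flow_step B0 L0 NB NL Hgam.
have rB : 2 * B <= rho by rewrite /rho; lra.
have h2 := billiard_step B0 L0 NL rB mmP xr.
rewrite gam0 gamE in h1.
have -> : Tmap M (Tmap M x) - time_one M D x =
    (Tmap M (Tmap M x) - x - vfield N x) - (time_one M D x - x - vfield N x).
  by rewrite opprB addrCA !addrA; apply/rowP => i; rewrite !mxE; ring.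
apply: le_trans (enormB _ _) _.
by rewrite mulrDl addrC; exact: lerD h1 h2.
Qed.
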